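(* Let $S$ be a unital inverse semigroup, let $S_r$ be its restricted semigroup, and let $\Lambda$ be the left regular representation of $S_r$. There are isometric isomorphisms of $C^*$-algebras $$C^*_{\lambda_r}(S)\simeq C^*_{\Lambda}(S_r)/\mathbb C\delta_0\qquad\text{and}\qquad C^*_r(S)\simeq C^*(S_r)/\mathbb C\delta_0 .$$
   Context: An inverse semigroup is a (discrete) semigroup $T$ in which every $s\in T$ has a unique $s^*$ with $ss^*s=s$, $s^*ss^*=s^*$. Idempotents are ordered by $e\le f$ iff $ef=e$. $S$ is an inverse semigroup with identity $1$. Restricted semigroup: $S_r=S\cup\{0\}$, where $0$ is a newly adjoined element with $0^*=0$, is an inverse semigroup with multiplication $x\bullet y=xy$ if $x,y\in S$ and $x^*x=yy^*$, and $x\bullet y=0$ otherwise. Representations: for an inverse semigroup $T$, $\Sigma(T)$ is the family of all maps $\pi:T\to B(\mathcal H_\pi)$ ($\mathcal H_\pi$ a Hilbert space) with $\pi(xy)=\pi(x)\pi(y)$, $\pi(x^* )=\pi(x)^*$ and $\sup_x\|\pi(x)\|\le 1$. $\Sigma_r(S)$ is the family of restricted representations of $S$: maps $\pi:S\to B(\mathcal H_\pi)$ with $\pi(x^* )=\pi(x)^*$, $\sup_x\|\pi(x)\|\le1$, and $\pi(x)\pi(y)=\pi(xy)$ if $x^*x=yy^*$, $\pi(x)\pi(y)=0$ otherwise. In each case put $\tilde\pi(f)=\sum_x f(x)\pi(x)$ for $f$ in the corresponding $\ell^1$-space. The left regular representation of an inverse semigroup $T$ on $\ell^2(T)$ is given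 by $(x\cdot\xi)(y)=\xi(x^*y)$ if $xx^*\ge yy^*$ and $0$ otherwise; for $T=S_r$ it is denoted $\Lambda$. The restricted left regular representation $\lambda_r\in\Sigma_r(S)$ on $\ell^2(S)$ is $(\lambda_r(x)\xi)(y)=\xi(x^*y)$ if $xx^*=yy^*$ and $0$ otherwise. Algebras: $\ell^1(S_r)$ is the usual convolution algebra of the semigroup $S_r$, with involution $\tilde f(x)=\overline{f(x^* )}$. $\ell^1_r(S)$ is $\ell^1(S)$ with product $(f\bullet g)(x)=\sum_{yy^*=x^*x}f(xy)g(y^* )$ and the same involution formula. Define: - $C^*_\Lambda(S_r)$: completion of $\ell^1(S_r)$ in the $C^*$-norm $\|f\|_\Lambda=\|\tilde\Lambda(f)\|$; - $C^*(S_r)$: completion of $\ell^1(S_r)$ in the $C^*$-norm $\|f\|=\sup\{\|\tilde\pi(f)\|:\pi\in\Sigma(S_r)\}$; - $C^*_{\lambda_r}(S)$: completion of $\ell^1_r(S)$ in the $C^*$-norm $\|f\|_{\lambda_r}=\|\tilde\lambda_r(f)\|$; - $C^*_r(S)$: completion of $\ell^1_r(S)$ in the $C^*$-norm $\|f\|_{\Sigma_r}=\sup\{\|\tilde\pi(f)\|:\pi\in\Sigma_r(S)\}$. $\delta_0\in\ell^1(S_r)$ is the point mass at $0$, and $\mathbb C\delta_0$ is regarded as a (closed) ideal in $C^*_\Lambda(S_r)$ and in $C^*(S_r)$. *)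

(* Defs.v *)
From HB Require Import structures.

From mathcomp Require Import all_boot all_order all_algebra finmap.
From mathcomp Require Import all_classical all_reals all_analysis.
From mathcomp Require Import ring lra.
From mathcomp.real_closed Require Import complex.
From mathcomp.analysis.showcase Require summability.

Set Implicit Arguments.
Unset Strict Implicit.
Unset Printing Implicit Defensive.

Import Order.TTheory GRing.Theory Num.Theory.
Import numFieldNormedType.Exports.

Local Open Scope classical_set_scope.
Local Open Scope ring_scope.

HB.mixin Record Semigroup_isInverse S of Semigroup S := {
  star : S -> S;
  mulg_star_mulg : forall s : S, (s * star s * s)%g = s;
  star_mulg_star : forall s : S, (star s * s * star s)%g = star s;
  star_unique : forall s t : S,
    (s * t * s)%g = s -> (t * s * t)%g = t -> t = star s
}.

#[short(type="inverseSemigroupType")]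
HB.structure Definition InverseSemigroup :=
  {S of Semigroup_isInverse S & Semigroup S}.

#[short(type="unitalInverseSemigroupType")]
HB.structure Definition UnitalInverseSemigroup :=
  {S of InverseSemigroup S & Monoid S}.

Section InverseSemigroupTheory.
Variable S : inverseSemigroupType.
Implicit Types s t e f : S.
Local Open Scope group_scope.

Definition idem e := e * e = e.

Definition idem_le e f := e * f == e.

Lemma starK s : star (star s) = s.
Proof.
apply: esym; apply: star_unique.
  exact: star_mulg_star.
exact: mulg_star_mulg.
Qed.

Lemma idem_star e : idem e -> star e = e.
Proof.
by rewrite /idem => ee; apply: esym; apply: star_unique; rewrite !ee.
Qed.

Lemma idemM e f : idem e -> idem f -> idem (e * f).
Proof.
rewrite /idem => ee ff.
set g := e * f; set t := star g.
have gtg : g * t * g = g by exact: mulg_star_mulg.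
have tgt : t * g * t = t by exact: star_mulg_star.
have Et : f * t * e = t.
  apply: star_unique.
    rewrite -[RHS]gtg /g !mulgA -(mulgA e f f) ff.
    by rewrite -(mulgA _ e e) ee.
  rewrite -[in RHS]tgt /g !mulgA -(mulgA _ e e) ee.
  by rewrite -(mulgA _ f f) ff.
have ft : f * t = t by rewrite -{1}Et !mulgA ff Et.
have te : t * e = t by rewrite -{1}Et -mulgA ee Et.
have tt : t * t = t by rewrite -[RHS]tgt /g !mulgA te -(mulgA t f) ft.
have gt : g = t by rewrite -(starK g) -/t idem_star.
by rewrite gt.
Qed.

Lemma idemC e f : idem e -> idem f -> e * f = f * e.
Proof.
move=> ie jf.
have iJ := idemM ie jf; have jI := idemM jf ie.
rewrite -(idem_star iJ); apply: esym; apply: star_unique.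
  rewrite !mulgA -(mulgA e f f) jf -(mulgA _ e e) ie.
  by rewrite -mulgA; exact: iJ.
rewrite !mulgA -(mulgA f e e) ie -(mulgA _ f f) jf.
by rewrite -mulgA; exact: jI.
Qed.

Lemma idem_mul_star s : idem (s * star s).
Proof. by rewrite /idem mulgA mulg_star_mulg. Qed.

Lemma idem_star_mul s : idem (star s * s).
Proof. by rewrite /idem mulgA star_mulg_star. Qed.

Lemma starM s t : star (s * t) = star t * star s.
Proof.
have C := idemC (idem_mul_star t) (idem_star_mul s).
apply: esym; apply: star_unique.
  transitivity (s * (t * star t * (star s * s)) * t); first by rewrite !mulgA.
  by rewrite C -[in RHS](mulg_star_mulg s) -[in RHS](mulg_star_mulg t) !mulgA.
transitivity (star t * (star s * s * (t * star t)) * star s).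
  by rewrite !mulgA.
rewrite -C -[in RHS](star_mulg_star s) -[in RHS](star_mulg_star t).
by rewrite !mulgA.
Qed.

End InverseSemigroupTheory.

(* [None] is the adjoined zero. *)
Definition restricted (S : Type) := option S.

Section Restricted.
Variable S : inverseSemigroupType.
Implicit Types x y z : restricted S.

HB.instance Definition _ := Choice.on (restricted S).

Definition restricted_mul x y : restricted S :=
  if (x, y) is (Some s, Some t) then
    if (star s * s == t * star t)%g then Some (s * t)%g else None
  else None.

Definition restricted_star x : restricted S :=
  if x is Some s then Some (star s) else None.

Lemma restricted_mulA : associative restricted_mul.
Proof.
move=> [a|] [b|] [c|]; rewrite /restricted_mul //=; last by case: ifP.
- have [ab|ab] := eqVneq (star a * a)%g (b * star b)%g.
  + have -> : (star (a * b) * (a * b) = star b * b)%g.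
      rewrite starM !mulgA -(mulgA (star b)) ab !mulgA star_mulg_star.
      by rewrite -?mulgA.
    have [bc|bc] := eqVneq (star b * b)%g (c * star c)%g; last by [].
    have -> : ((b * c) * star (b * c) = b * star b)%g.
      by rewrite starM !mulgA -(mulgA b) -bc !mulgA mulg_star_mulg.
    by rewrite ab eqxx mulgA.
  + have [bc|//] := eqVneq (star b * b)%g (c * star c)%g.
    have -> : ((b * c) * star (b * c) = b * star b)%g.
      by rewrite starM !mulgA -(mulgA b) -bc !mulgA mulg_star_mulg.
    by rewrite (negbTE ab).
Qed.

HB.instance Definition _ := isSemigroup.Build (restricted S) restricted_mulA.

Lemma restricted_mul_star_mul x :
  (x * restricted_star x * x)%g = x.
Proof.
case: x => [s|//].
rewrite -[LHS]/(restricted_mul (restricted_mul (Some s) (Some (star s))) _).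
rewrite /restricted_mul /= starK eqxx starM starK idem_mul_star eqxx.
by rewrite mulg_star_mulg.
Qed.

Lemma restricted_starK : involutive restricted_star.
Proof. by case=> [s|] //=; rewrite starK. Qed.

Lemma restricted_star_mul_star x :
  (restricted_star x * x * restricted_star x)%g = restricted_star x.
Proof.
have := restricted_mul_star_mul (restricted_star x).
by rewrite restricted_starK.
Qed.

Lemma restricted_mul_some (s t u : S) :
  restricted_mul (Some s) (Some t) = Some u -> (s * t)%g = u.
Proof. by rewrite /restricted_mul; case: ifP => // _ []. Qed.

Lemma restricted_star_unique x y :
  (x * y * x)%g = x -> (y * x * y)%g = y -> y = restricted_star x.
Proof.
case: x y => [s|] [t|] //=.
move=> E1 E2; congr Some; apply: star_unique.
- move: E1; rewrite -[LHS]/(restricted_mul (restricted_mul _ _) _).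
  case E: (restricted_mul (Some s) _) => [u|//].
  by move=> /restricted_mul_some us; rewrite (restricted_mul_some E).
- move: E2; rewrite -[LHS]/(restricted_mul (restricted_mul _ _) _).
  case E: (restricted_mul (Some t) _) => [u|//].
  by move=> /restricted_mul_some us; rewrite (restricted_mul_some E).
Qed.

HB.instance Definition _ := Semigroup_isInverse.Build (restricted S)
  restricted_mul_star_mul restricted_star_mul_star restricted_star_unique.

End Restricted.

Section RealNorm.
Variables (R : realType) (V : normedModType R[i]).
Implicit Types u v : V.

(* The norms of the library take values in the field of scalars, here R[i]. *)
Definition rnorm v : R := complex.Re `|v|.

Lemma rnormE v : ((rnorm v)%:C)%C = `|v|.
Proof. by rewrite RRe_real// normr_real. Qed.

Lemma rnorm_ge0 v : 0 <= rnorm v.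
Proof. by rewrite -ler0c rnormE. Qed.

Lemma rnormD u v : rnorm (u + v) <= rnorm u + rnorm v.
Proof. by rewrite -lecR rmorphD/= !rnormE ler_normD. Qed.

Lemma rnormZ (a : R[i]) v : rnorm (a *: v) = complex.Re `|a| * rnorm v.
Proof. by apply: complexI; rewrite rmorphM/= !rnormE normrZ. Qed.

Lemma rnorm0 : rnorm 0 = 0.
Proof. by rewrite /rnorm normr0. Qed.

Lemma rnorm0_eq0 v : rnorm v = 0 -> v = 0.
Proof. by move=> v0; apply/normr0_eq0; rewrite -rnormE v0. Qed.

End RealNorm.

Lemma rnormM (R : realType) (a b : R[i]^o) :
  rnorm (a * b : R[i]^o) = rnorm a * rnorm b.
Proof. exact: rnormZ. Qed.

Section EsumFacts.
Variables (R : realType) (T : choiceType).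
Local Open Scope ereal_scope.

Lemma esumZl (c : R) (D : set T) (a : T -> \bar R) : (0 <= c)%R ->
  (forall x, 0 <= a x) ->
  \esum_(x in D) (c%:E * a x) = c%:E * \esum_(x in D) a x.
Proof.
have le_c (k : R) (b : T -> \bar R) : (0 <= k)%R -> (forall x, 0 <= b x) ->
    \esum_(x in D) (k%:E * b x) <= k%:E * \esum_(x in D) b x.
  move=> k0 b0; apply: ge_ereal_sup => _ [X [finX XD] <-].
  rewrite -ge0_mule_fsumr//; apply: lee_wpmul2l; first by rewrite lee_fin.
  by apply: esum_ge; exists X.
move=> c0 a0; apply/eqP; rewrite eq_le le_c//=.
have [->|cn0] := eqVneq c 0%R.
  by rewrite mul0e esum_ge0// => x _; rewrite mul0e.
have {cn0}c0 : (0 < c)%R by rewrite lt_def cn0.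
have -> : \esum_(x in D) a x = \esum_(x in D) (c^-1%:E * (c%:E * a x)).
  by apply: eq_esum => x _; rewrite muleA -EFinM mulVf ?mul1e// gt_eqF.
have cV0 : (0 <= c^-1)%R by rewrite invr_ge0 ltW.
apply: le_trans (lee_wpmul2l _ (le_c _ _ cV0 _)) _.
- by rewrite lee_fin ltW.
- by move=> x; rewrite mule_ge0// lee_fin ltW.
- by rewrite muleA -EFinM divff ?mul1e// gt_eqF.
Qed.

Lemma le_esum_lty (D : set T) (a b : T -> \bar R) :
  (forall x, a x <= b x) -> \esum_(x in D) b x < +oo -> \esum_(x in D) a x < +oo.
Proof. by move=> ab; apply: le_lt_trans; apply: le_esum => x _; exact: ab. Qed.

Lemma subset_esum (D E : set T) (a : T -> \bar R) : (forall x, 0 <= a x) ->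
  D `<=` E -> \esum_(x in D) a x <= \esum_(x in E) a x.
Proof.
move=> a0 DE; rewrite (esumID D E)//.
have -> : E `&` D = D by rewrite setIC; apply/setIidPl.
by rewrite leeDl// esum_ge0.
Qed.

End EsumFacts.

Lemma esum_inj_le (R : realType) (T U : choiceType) (D : set T) (h : T -> U)
    (a : U -> \bar R) : (forall x, (0 <= a x)%E) -> set_inj D h ->
  (\esum_(x in D) a (h x) <= \esum_(y in setT) a y)%E.
Proof. by move=> a0 hD; rewrite -esum_image//; apply: subset_esum. Qed.

Lemma rnorm_sum_le (R : realType) (I : choiceType)
    (F : I -> R[i]^o) :
  ((rnorm (summability.sum F))%:E <= \esum_(i in setT) (rnorm (F i))%:E)%E.
Proof.
have [Foo|/eqP Foo] := eqVneq (\esum_(i in setT) (rnorm (F i))%:E)%E +oo%E.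
  by rewrite Foo leey.
have M0 : (0 <= \esum_(i in setT) (rnorm (F i))%:E)%E.
  by apply: esum_ge0 => i _; rewrite lee_fin rnorm_ge0.
set M := fine (\esum_(i in setT) (rnorm (F i))%:E)%E.
have ME : (\esum_(i in setT) (rnorm (F i))%:E = M%:E)%E.
  by rewrite fineK// ge0_fin_numE// ltey; apply/eqP.
rewrite ME lee_fin.
have bnd (A : {fset I}) : rnorm (summability.partial_sum F A) <= M.
  have : rnorm (summability.partial_sum F A) <= \sum_(i : A) rnorm (F (val i)).
    rewrite /summability.partial_sum.
    apply: (big_ind2 (fun (v : R[i]^o) (r : R) => rnorm v <= r)) => [|x1 x2 y1 y2 h1 h2|//].
      by move: (rnorm0 R[i]^o) => /eqP; rewrite eq_le => /andP[].
    by rewrite (le_trans (rnormD _ _))// lerD.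
  move/le_trans; apply.
  rewrite -lee_fin -ME; apply: esum_ge; exists [set` A].
    by split; [exact: finite_fset|].
  rewrite fsbig_finite//= set_fsetK big_seq_fsetE/=.
  by rewrite sumEFin.
have [cv|dv] := pselect (cvg (summability.partial_sum F @ summability.totally));
    last first.
  have p0 : point = 0 :> R[i]^o by [].
  by rewrite /summability.sum (dvgP dv) p0 rnorm0 -lee_fin -ME.
have FF := @summability.totally_filter I.
apply/ler_addgt0Pr => e e0; rewrite addrC.
have e0C : 0 < e%:C%C by rewrite ltcR.
have /cvgrPdist_lt/(_ _ e0C)/filter_ex[A] := cv.
rewrite -/(summability.sum F) -rnormE ltcR => /ltW Ae.
rewrite -(subrK (summability.partial_sum F A) (summability.sum F)).
by rewrite (le_trans (rnormD _ _))// lerD.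
Qed.

Section Ell.
Variables (R : realType) (T : choiceType).
Implicit Types f g : T -> R[i]^o.

Definition l1_pred : {pred T -> R[i]^o} :=
  [pred f | \esum_(x in setT) (rnorm (f x))%:E < +oo]%E.

Definition l2_pred : {pred T -> R[i]^o} :=
  [pred f | \esum_(x in setT) (rnorm (f x) ^+ 2)%:E < +oo]%E.

Lemma l1_pred_submod : submod_closed l1_pred.
Proof.
split=> [|c f g]; rewrite !inE.
  by rewrite esum1// => x _; rewrite rnorm0.
move=> ff gg.
have c0 : 0 <= complex.Re `|c| := rnorm_ge0 (c : R[i]^o).
apply: (@le_esum_lty _ _ _ _ (fun x =>
    (complex.Re `|c|)%:E * (rnorm (f x))%:E + (rnorm (g x))%:E)%E) => [x|].
  by rewrite -EFinM -EFinD lee_fin (le_trans (rnormD _ _))// rnormZ.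
rewrite esumD; last 2 first.
- by move=> x _; rewrite mule_ge0 ?lee_fin ?rnorm_ge0.
- by move=> x _; rewrite lee_fin rnorm_ge0.
rewrite esumZl//; last by move=> x; rewrite lee_fin rnorm_ge0.
rewrite lte_add_pinfty// lte_mul_pinfty// ?lee_fin//.
Qed.

Lemma l2_pred_submod : submod_closed l2_pred.
Proof.
split=> [|c f g]; rewrite !inE.
  by rewrite esum1// => x _; rewrite rnorm0 expr0n.
move=> ff gg.
have c0 : 0 <= 2 * (complex.Re `|c|) ^+ 2 by rewrite mulr_ge0 ?sqr_ge0.
apply: (@le_esum_lty _ _ _ _ (fun x => (2 * (complex.Re `|c|) ^+ 2)%:E *
    (rnorm (f x) ^+ 2)%:E + 2%:E * (rnorm (g x) ^+ 2)%:E)%E) => [x|].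
  rewrite -!EFinM -EFinD lee_fin.
  have := rnormD (c *: f x) (g x); rewrite rnormZ => h.
  apply: le_trans (_ : (complex.Re `|c| * rnorm (f x) + rnorm (g x)) ^+ 2 <= _).
    by rewrite lerXn2r ?nnegrE ?addr_ge0 ?mulr_ge0 ?rnorm_ge0//; exact: (rnorm_ge0 (c : R[i]^o)).
  have := sqr_ge0 (complex.Re `|c| * rnorm (f x) - rnorm (g x)).
  nra.
rewrite esumD; last 2 first.
- by move=> x _; rewrite mule_ge0 ?lee_fin ?sqr_ge0.
- by move=> x _; rewrite mule_ge0 ?lee_fin ?sqr_ge0.
rewrite !esumZl//; try by move=> x; rewrite lee_fin sqr_ge0.
by rewrite lte_add_pinfty// lte_mul_pinfty// ?lee_fin.
Qed.

HB.instance Definition _ :=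
  GRing.isSubmodClosed.Build R[i] (T -> R[i]^o) l1_pred l1_pred_submod.
HB.instance Definition _ :=
  GRing.isSubmodClosed.Build R[i] (T -> R[i]^o) l2_pred l2_pred_submod.

Record l1 := L1 { l1_fun :> T -> R[i]^o; l1_funP : l1_fun \in l1_pred }.
Record l2 := L2 { l2_fun :> T -> R[i]^o; l2_funP : l2_fun \in l2_pred }.

HB.instance Definition _ := [isSub for l1_fun].
HB.instance Definition _ := [isSub for l2_fun].
HB.instance Definition _ := [Choice of l1 by <:].
HB.instance Definition _ := [Choice of l2 by <:].
HB.instance Definition _ := [SubChoice_isSubLmodule of l1 by <:].
HB.instance Definition _ := [SubChoice_isSubLmodule of l2 by <:].

End Ell.

Section Delta.
Variables (R : realType) (T : choiceType) (t : T).

Lemma delta_l1 : ((fun x => (x == t)%:R) : T -> R[i]^o) \in @l1_pred R T.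
Proof.
rewrite inE; apply: le_lt_trans (_ : \esum_(x in [set t]) 1%:E < +oo)%E; last first.
  by rewrite esum_set1// ?ltry// lee_fin.
rewrite [leRHS]esum_mkcond; apply: le_esum => x _.
have [->|xt] := eqVneq x t.
  by rewrite mem_set// lee_fin /rnorm normr1.
by rewrite memNset ?lee_fin ?rnorm0//; exact/eqP.
Qed.

Definition delta : l1 R T := L1 delta_l1.
End Delta.

Section L2Norm.
Variables (R : realType) (T : choiceType).
Implicit Types f g : l2 R T.

Definition l2_norm f : R :=
  Num.sqrt (fine (\esum_(x in setT) (rnorm (f x) ^+ 2)%:E)%E).

Let l2_fin f :
  (\esum_(x in setT) (rnorm (f x) ^+ 2)%:E = (l2_norm f ^+ 2)%:E)%E.
Proof.
have f0 : (0 <= \esum_(x in setT) (rnorm (f x) ^+ 2)%:E)%E.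
  by apply: esum_ge0 => x _; rewrite lee_fin sqr_ge0.
rewrite sqr_sqrtr ?fine_ge0// fineK// ge0_fin_numE//.
by have := l2_funP f; rewrite inE.
Qed.

Let l2_norm_le f (M : R) : 0 <= M ->
  (\esum_(x in setT) (rnorm (f x) ^+ 2)%:E <= (M ^+ 2)%:E)%E -> l2_norm f <= M.
Proof.
by move=> M0; rewrite l2_fin lee_fin ler_sqr ?nnegrE ?sqrtr_ge0.
Qed.

Lemma l2_norm0_eq0 f : l2_norm f = 0 -> f = 0.
Proof.
move=> f0; apply/val_inj/funext => x; apply: rnorm0_eq0.
have : ((rnorm (f x) ^+ 2)%:E <= (0%R ^+ 2)%:E)%E.
  rewrite -f0 -l2_fin.
  rewrite -(@esum_set1 _ _ x (fun y => (rnorm (f y) ^+ 2)%:E)%E) ?lee_fin ?sqr_ge0//.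
  by apply: subset_esum => // y; rewrite lee_fin sqr_ge0.
rewrite lee_fin expr0n/= => h; apply/eqP; rewrite -sqrf_eq0 eq_le h.
by rewrite sqr_ge0.
Qed.

Lemma l2_normD f g : l2_norm (f + g) <= l2_norm f + l2_norm g.
Proof.
have a0 := sqrtr_ge0 (fine (\esum_(x in setT) (rnorm (f x) ^+ 2)%:E)%E).
have b0 := sqrtr_ge0 (fine (\esum_(x in setT) (rnorm (g x) ^+ 2)%:E)%E).
rewrite -/(l2_norm f) in a0; rewrite -/(l2_norm g) in b0.
have [/l2_norm0_eq0 ->|an0] := eqVneq (l2_norm f) 0.
  by rewrite add0r lerDr sqrtr_ge0.
have [/l2_norm0_eq0 ->|bn0] := eqVneq (l2_norm g) 0.
  by rewrite addr0 lerDl sqrtr_ge0.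
set a := l2_norm f in a0 an0 *; set b := l2_norm g in b0 bn0 *.
have {an0}a0 : 0 < a by rewrite lt_def an0.
have {bn0}b0 : 0 < b by rewrite lt_def bn0.
apply: l2_norm_le; first by rewrite addr_ge0// ltW.
have -> : ((a + b) ^+ 2 = (1 + b / a) * a ^+ 2 + (1 + a / b) * b ^+ 2).
  by field; rewrite !gt_eqF.
have ba : 0 <= 1 + b / a by rewrite addr_ge0// divr_ge0// ltW.
have ab : 0 <= 1 + a / b by rewrite addr_ge0// divr_ge0// ltW.
rewrite EFinD (EFinM (1 + b / a)) (EFinM (1 + a / b)) -(l2_fin f) -(l2_fin g).
rewrite -!esumZl//; try by move=> x; rewrite lee_fin sqr_ge0.
rewrite -esumD; try by move=> x _; rewrite mule_ge0 ?lee_fin ?sqr_ge0.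
apply: le_esum => x _; rewrite -!EFinM -EFinD lee_fin.
set u := rnorm (f x); set v := rnorm (g x).
apply: le_trans (_ : (u + v) ^+ 2 <= _).
  rewrite lerXn2r ?nnegrE ?addr_ge0 ?rnorm_ge0//; exact: rnormD.
have -> : (1 + b / a) * u ^+ 2 + (1 + a / b) * v ^+ 2 =
    (u + v) ^+ 2 + (b * u - a * v) ^+ 2 / (a * b).
  by field; rewrite !gt_eqF.
by rewrite lerDl divr_ge0 ?sqr_ge0// mulr_ge0// ltW.
Qed.

Lemma l2_normZ (c : R[i]) f : l2_norm (c *: f) = complex.Re `|c| * l2_norm f.
Proof.
have c0 : 0 <= complex.Re `|c| := rnorm_ge0 (c : R[i]^o).
apply/eqP; rewrite -(@eqrXn2 _ 2)// ?sqrtr_ge0 ?mulr_ge0 ?sqrtr_ge0//.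
rewrite -eqe -l2_fin exprMn EFinM -l2_fin -esumZl ?sqr_ge0//; last first.
  by move=> x; rewrite lee_fin sqr_ge0.
by apply/eqP/eq_esum => x _; rewrite -EFinM -exprMn -rnormZ.
Qed.

Let norm f : R[i] := (l2_norm f)%:C%C.

Let normD f g : norm (f + g) <= norm f + norm g.
Proof. by rewrite /norm -rmorphD/= lecR l2_normD. Qed.

Let normZ (c : R[i]) f : norm (c *: f) = `|c| * norm f.
Proof.
rewrite /norm l2_normZ rmorphM/= -[in RHS](rnormE (c : R[i]^o)).
by [].
Qed.

Let norm0_eq0 f : norm f = 0 -> f = 0.
Proof. by move=> [/l2_norm0_eq0]. Qed.

HB.instance Definition _ :=
  Lmodule_isNormed.Build R[i] (l2 R T) normD normZ norm0_eq0.

End L2Norm.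

Record hilbertSpace (R : realType) := HilbertSpace {
  hilbert_sort :> completeNormedModType R[i];
  inner : {dot hilbert_sort for Num.conj};
  inner_norm : forall v : hilbert_sort, `|v| ^+ 2 = inner v v
}.

Section Operators.
Variables (R : realType) (H : normedModType R[i]) (T : choiceType).

Definition opnorm (u : H -> H) : R :=
  sup [set rnorm (u v) | v in [set v | rnorm v <= 1]].

(* The series is absolutely convergent in the operator norm when f is in l1 and
   the operators [pi x] are contractions, so it may be evaluated pointwise. *)
Definition rep_ext (pi : T -> H -> H) (f : T -> R[i]) : H -> H :=
  fun v => summability.sum (fun x => f x *: pi x v).

End Operators.

Section Representations.
Variables (R : realType) (T : inverseSemigroupType) (H : hilbertSpace R).
Implicit Types pi : T -> {linear H -> H}.

Record representation pi : Prop := Representation {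
  rep_contraction : forall x v, `|pi x v| <= `|v|;
  rep_adjoint : forall x u v, inner H (pi (star x) u) v = inner H u (pi x v);
  rep_mul : forall x y v, pi x (pi y v) = pi (x * y)%g v
}.

Record restricted_representation pi : Prop := RestrictedRepresentation {
  rrep_contraction : forall x v, `|pi x v| <= `|v|;
  rrep_adjoint : forall x u v, inner H (pi (star x) u) v = inner H u (pi x v);
  rrep_mul : forall x y v, (star x * x)%g = (y * star y)%g ->
    pi x (pi y v) = pi (x * y)%g v;
  rrep_mul0 : forall x y v, (star x * x)%g <> (y * star y)%g ->
    pi x (pi y v) = 0
}.

End Representations.

Section RegularRepresentations.
Variables (R : realType) (T : inverseSemigroupType).

Lemma l2_transport (D : {pred T}) (h : T -> T) (xi : l2 R T) :
  {in D &, injective h} ->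
  (fun y => if y \in D then xi (h y) else 0) \in @l2_pred R T.
Proof.
move=> hD; rewrite inE; apply: le_lt_trans (l2_funP xi).
apply: le_trans (esum_inj_le (D := [set` D]) (h := h) _ _); last 2 first.
- by move=> y; rewrite lee_fin sqr_ge0.
- by move=> y z; rewrite !inE; exact: hD.
rewrite [leRHS]esum_mkcond; apply: le_esum => y _.
have [yD|yD] := boolP (y \in D); first by rewrite mem_set.
by rewrite memNset; [rewrite lee_fin rnorm0 expr0n|exact/negP].
Qed.

Lemma left_regular_l2 (x : T) (xi : l2 R T) :
  (fun y => if idem_le (y * star y)%g (x * star x)%g then xi (star x * y)%g
            else 0)
    \in @l2_pred R T.
Proof.
apply: (l2_transport (D := [pred y | idem_le (y * star y)%g (x * star x)%g])).
have K (y : T) : idem_le (y * star y)%g (x * star x)%g -> (x * (star x * y) = y)%g.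
  move=> /eqP yx; rewrite mulgA -{1}(mulg_star_mulg y) mulgA.
  by rewrite (idemC (idem_mul_star x) (idem_mul_star y)) yx mulg_star_mulg.
by move=> y z /K yK /K zK yz; rewrite -yK yz zK.
Qed.

Definition left_regular (x : T) (xi : l2 R T) : l2 R T :=
  L2 (left_regular_l2 x xi).

Lemma restricted_left_regular_l2 (x : T) (xi : l2 R T) :
  (fun y => if (x * star x == y * star y)%g then xi (star x * y)%g else 0)
    \in @l2_pred R T.
Proof.
apply: (l2_transport (D := [pred y | (x * star x == y * star y)%g])).
have K (y : T) : (x * star x == y * star y)%g -> (x * (star x * y) = y)%g.
  by move=> /eqP xy; rewrite mulgA xy mulg_star_mulg.
by move=> y z /K yK /K zK yz; rewrite -yK yz zK.
Qed.

Definition restricted_left_regular (x : T) (xi : l2 R T) : l2 R T :=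
  L2 (restricted_left_regular_l2 x xi).

End RegularRepresentations.

Section L1Algebras.
Variables (R : realType) (T : inverseSemigroupType).
Implicit Types f g : l1 R T.

Lemma l1_star_l1 f : (fun x => (f (star x))^*) \in @l1_pred R T.
Proof.
rewrite inE; apply: le_lt_trans (l1_funP f).
apply: le_trans (esum_inj_le (D := setT) (h := @star T) _ _); last 2 first.
- by move=> y; rewrite lee_fin rnorm_ge0.
- by move=> y z _ _ yz; rewrite -(starK y) yz starK.
by apply: le_esum => x _; rewrite /rnorm norm_conjC.
Qed.

Definition l1_star f : l1 R T := L1 (l1_star_l1 f).

Let prod_lty f g :
  (\esum_(p in [set: T * T]) (rnorm (f p.1) * rnorm (g p.2))%:E < +oo)%E.
Proof.
have -> : [set: T * T] = [set: T] `*`` (fun=> [set: T]) by apply/seteqP; split.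
rewrite -(@esum_esum R T T setT (fun=> setT)
  (fun x y => (rnorm (f x) * rnorm (g y))%:E)%E); last first.
  by move=> x y _ _; rewrite lee_fin mulr_ge0 ?rnorm_ge0.
have g0 : (0 <= \esum_(y in setT) (rnorm (g y))%:E)%E.
  by apply: esum_ge0 => y _; rewrite lee_fin rnorm_ge0.
have /fineK gE : (\esum_(y in setT) (rnorm (g y))%:E)%E \is a fin_num.
  by rewrite ge0_fin_numE//; have := l1_funP g; rewrite inE.
under eq_esum => x _.
  under eq_esum => y _ do rewrite EFinM.
  rewrite esumZl ?rnorm_ge0//; last by move=> y; rewrite lee_fin rnorm_ge0.
  rewrite -gE muleC; over.
rewrite esumZl ?fine_ge0//; last by move=> x; rewrite lee_fin rnorm_ge0.
by rewrite lte_mul_pinfty ?lee_fin ?fine_ge0//; have := l1_funP f; rewrite inE.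
Qed.

Lemma l1_conv_l1 f g :
  (fun x => summability.sum
     (fun p : T * T => (if (p.1 * p.2 == x)%g then f p.1 * g p.2
                        else 0) : R[i]^o))
    \in @l1_pred R T.
Proof.
rewrite inE; apply: le_lt_trans (prod_lty f g).
pose a (p : T * T) : \bar R := ((rnorm (f p.1) * rnorm (g p.2))%:E)%E.
have a0 p : (0 <= a p)%E by rewrite lee_fin mulr_ge0 ?rnorm_ge0.
pose D (x : T) := [set p : T * T | (p.1 * p.2)%g = x].
apply: (@le_trans _ _ (\esum_(x in setT) \esum_(p in D x) a p)%E).
  apply: le_esum => x _; apply: le_trans (rnorm_sum_le _) _.
  rewrite [leRHS]esum_mkcond; apply: le_esum => p _.
  have [px|px] := eqVneq (p.1 * p.2)%g x.
    by rewrite mem_set// lee_fin rnormM.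
  by rewrite memNset ?lee_fin ?rnorm0//; exact/eqP.
rewrite esum_esum//; apply: (@esum_inj_le _ _ _ _ snd a a0).
by move=> [x p] [y q]; rewrite !inE/= => -[_ <-] [_ <-] ->.
Qed.

Definition l1_conv f g : l1 R T := L1 (l1_conv_l1 f g).

Lemma l1_rconv_l1 f g :
  (fun x => summability.sum
     (fun y : T => (if (y * star y == star x * x)%g
                    then f (x * y)%g * g (star y) else 0) : R[i]^o))
    \in @l1_pred R T.
Proof.
rewrite inE; apply: le_lt_trans (prod_lty f g).
pose a (p : T * T) : \bar R := ((rnorm (f p.1) * rnorm (g p.2))%:E)%E.
have a0 p : (0 <= a p)%E by rewrite lee_fin mulr_ge0 ?rnorm_ge0.
pose h (p : T * T) := ((p.1 * p.2)%g, star p.2).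
pose D (x : T) := [set y : T | (y * star y = star x * x)%g].
apply: (@le_trans _ _ (\esum_(x in setT) \esum_(y in D x) a (h (x, y)))%E).
  apply: le_esum => x _; apply: le_trans (rnorm_sum_le _) _.
  rewrite [leRHS]esum_mkcond; apply: le_esum => y _.
  have [px|px] := eqVneq (y * star y)%g (star x * x)%g.
    by rewrite mem_set// lee_fin rnormM.
  by rewrite memNset ?lee_fin ?rnorm0//; exact/eqP.
rewrite (@esum_esum _ _ _ _ _ (fun x y => a (h (x, y))))//.
rewrite (eq_esum (b := fun p => a (h p))); last by move=> [].
apply: (esum_inj_le a0) => -[x y] [z w]; rewrite !inE/= => -[_ xy] [_ zw] [E1 E2].
have yw : y = w by rewrite -(starK y) E2 starK.
rewrite -yw in E1 zw *; congr pair.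
by rewrite -(mulg_star_mulg x) -mulgA -xy mulgA E1 -mulgA zw mulgA mulg_star_mulg.
Qed.

Definition l1_rconv f g : l1 R T := L1 (l1_rconv_l1 f g).

End L1Algebras.

(* Only the data, so that l1-algebras with their various C*-norms, C*-algebras
   and quotients can all be compared; no laws are imposed at this level. *)
Record normedStarAlgebra (R : realType) := NormedStarAlgebra {
  nsa_sort :> lmodType R[i];
  nsa_mul : nsa_sort -> nsa_sort -> nsa_sort;
  nsa_star : nsa_sort -> nsa_sort;
  nsa_norm : nsa_sort -> R
}.

Record cstarAlgebra (R : realType) := CstarAlgebra {
  cstar_sort :> completeNormedModType R[i];
  cstar_mul : cstar_sort -> cstar_sort -> cstar_sort;
  cstar_star : cstar_sort -> cstar_sort;
  cstar_mulA : associative cstar_mul;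
  cstar_mulDl : left_distributive cstar_mul +%R;
  cstar_mulDr : right_distributive cstar_mul +%R;
  cstar_mulZl : forall (c : R[i]) a b,
    cstar_mul (c *: a) b = c *: cstar_mul a b;
  cstar_mulZr : forall (c : R[i]) a b,
    cstar_mul a (c *: b) = c *: cstar_mul a b;
  cstar_starD : {morph cstar_star : a b / a + b};
  cstar_starZ : forall (c : R[i]) a, cstar_star (c *: a) = c^* *: cstar_star a;
  cstar_starM : forall a b,
    cstar_star (cstar_mul a b) = cstar_mul (cstar_star b) (cstar_star a);
  cstar_starK : involutive cstar_star;
  cstar_normM : forall a b, `|cstar_mul a b| <= `|a| * `|b|;
  cstar_identity : forall a, `|cstar_mul (cstar_star a) a| = `|a| ^+ 2
}.

Definition nsa_of_cstar (R : realType) (A : cstarAlgebra R) :=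
  @NormedStarAlgebra R A (@cstar_mul R A) (@cstar_star R A) (@rnorm R A).
Coercion nsa_of_cstar : cstarAlgebra >-> normedStarAlgebra.

(* A C*-completion of A: a C*-algebra together with an isometric *-homomorphism
   from A onto a dense subalgebra. It is unique up to isometric isomorphism. *)
Record cstarCompletion (R : realType) (A : normedStarAlgebra R) :=
  CstarCompletion {
  completion_alg :> cstarAlgebra R;
  completion_emb : {linear A -> (completion_alg : completeNormedModType R[i])};
  completion_embM : forall a b,
    completion_emb (nsa_mul a b) =
    cstar_mul (completion_emb a) (completion_emb b);
  completion_emb_star : forall a,
    completion_emb (nsa_star a) = cstar_star (completion_emb a);
  completion_emb_norm : forall a, rnorm (completion_emb a) = nsa_norm a;
  completion_emb_dense : dense (range completion_emb)
}.

Definition isometrically_isomorphic (R : realType) (A B : normedStarAlgebra R) :=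
  exists phi : {linear A -> B},
    [/\ bijective phi,
        {morph phi : a b / nsa_mul a b >-> nsa_mul a b},
        {morph phi : a / nsa_star a >-> nsa_star a} &
        forall a, nsa_norm (phi a) = nsa_norm a].

Section Line.
Variables (K : pzRingType) (V : lmodType K) (d : V).

Definition line : {pred V} := [pred v | `[< exists c : K, v = c *: d >]].

Lemma line_submod : submod_closed line.
Proof.
split=> [|c u v]; first by apply/asboolP; exists 0; rewrite scale0r.
move=> /asboolP[a ->] /asboolP[b ->]; apply/asboolP; exists (c * a + b).
by rewrite scalerDl scalerA.
Qed.

HB.instance Definition _ := GRing.isSubmodClosed.Build K V line line_submod.

End Line.

Section Quotient.
Variables (R : realType) (A : normedStarAlgebra R).
Variable d : A.
Local Open Scope quotient_scope.

Local Notation Q := {ideal_quot (line d)}.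

Fact quot_piD (a b : A) : \pi_Q (a + b) = \pi_Q a + \pi_Q b.
Proof. by rewrite piE. Qed.

Definition quot_scale (c : R[i]) (q : Q) : Q := \pi_Q (c *: repr q).

Lemma quot_scaleE c (a : A) : quot_scale c (\pi_Q a) = \pi_Q (c *: a).
Proof.
apply/eqP; rewrite -Quotient.idealrBE -scalerBr rpredZ//.
by rewrite Quotient.idealrBE reprK.
Qed.

Fact quot_scalerA b c q : quot_scale b (quot_scale c q) = quot_scale (b * c) q.
Proof. by rewrite -[q]reprK !quot_scaleE scalerA reprK. Qed.

Fact quot_scale1r : left_id 1 quot_scale.
Proof. by move=> q; rewrite -[q]reprK quot_scaleE scale1r. Qed.

Fact quot_scalerDr : right_distributive quot_scale +%R.
Proof.
move=> c p q; rewrite -[p]reprK -[q]reprK -quot_piD.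
by rewrite !quot_scaleE scalerDr quot_piD.
Qed.

Fact quot_scalerDl q : {morph quot_scale^~ q : b c / b + c}.
Proof.
by move=> b c; rewrite -[q]reprK !quot_scaleE scalerDl quot_piD.
Qed.

Definition quot_lmod : Type := Q.
HB.instance Definition _ := GRing.Zmodule.on quot_lmod.
HB.instance Definition _ := GRing.Zmodule_isLmodule.Build R[i] quot_lmod
  quot_scalerA quot_scale1r quot_scalerDr quot_scalerDl.

(* The quotient of A by the line spanned by d, with the quotient norm.
   Multiplication and involution are computed on representatives, which is
   independent of their choice when the line is a two-sided *-ideal. *)
Definition line_quotient : normedStarAlgebra R := @NormedStarAlgebra R quot_lmod
  (fun p q => \pi_Q (nsa_mul (repr (p : Q)) (repr (q : Q))))
  (fun q => \pi_Q (nsa_star (repr (q : Q))))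
  (fun q => inf [set nsa_norm a | a in [set a : A | \pi_Q a = q]]).

End Quotient.
Arguments line_quotient {R} A d.

Section Algebras.
Variable R : realType.

Definition lambda_r_norm (S : inverseSemigroupType) (f : l1 R S) : R :=
  opnorm (rep_ext (@restricted_left_regular R S) f).

Definition Lambda_norm (T : inverseSemigroupType) (f : l1 R T) : R :=
  opnorm (rep_ext (@left_regular R T) f).

Definition Sigma_r_norm (S : inverseSemigroupType) (f : l1 R S) : R :=
  sup [set r | exists (H : hilbertSpace R) (pi : S -> {linear H -> H}),
    restricted_representation pi /\ r = opnorm (rep_ext pi f)].

Definition Sigma_norm (T : inverseSemigroupType) (f : l1 R T) : R :=
  sup [set r | exists (H : hilbertSpace R) (pi : T -> {linear H -> H}),
    representation pi /\ r = opnorm (rep_ext pi f)].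

Definition l1_alg (T : inverseSemigroupType) (N : l1 R T -> R) :=
  @NormedStarAlgebra R (l1 R T) (@l1_conv R T) (@l1_star R T) N.

Definition l1_restricted_alg (S : inverseSemigroupType) (N : l1 R S -> R) :=
  @NormedStarAlgebra R (l1 R S) (@l1_rconv R S) (@l1_star R S) N.

Definition delta0 (S : inverseSemigroupType) : l1 R (restricted S) :=
  delta R (None : restricted S).

End Algebras.

(* Main.v *)
Require Import Defs.
From mathcomp Require Import all_boot all_order all_algebra.
From mathcomp Require Import all_classical all_reals all_analysis.
From HB Require Import structures.
From mathcomp Require Import finmap lra.
From mathcomp.real_closed Require Import complex.
From mathcomp.analysis.showcase Require Import summability.

(** Two facts carry the theorem.  First, for every f in l1(S_r) the products of f
    with delta_0, on either side, are the scalar (sum f) times delta_0, because 0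
    absorbs.  Hence the image d of delta_0 in either completion A of l1(S_r) is a
    central projection and A d is the line through d, so passing to A / C d
    amounts to cutting A down by 1 - d: the map [cut d], a |-> a - a d, is a
    *-homomorphism which kills d and takes a constant value on each coset of
    C d.  It is contractive ([rnorm_cut_le]), so the quotient norm of a coset is
    the norm of that value ([line_quotient_isomorphic]).

    Second, extend f in l1(S) by 0 at the adjoined zero and call the result
    [ext0 f].  The product of S_r agrees with the restricted product of S except
    for the value 0, so [ext0] is a *-homomorphism up to multiples of delta_0,
    and f |-> cut d (ext0 f) is an honest *-homomorphism from l1_r(S) to A.  It
    is isometric: cut d (ext0 f) is the image of ext0 f - (sum f) delta_0, and
    under a representation pi of S_r this element acts as f does under the family
    s |-> pi s - pi 0.  Those families are precisely the restricted
    representations of S ([Sigma_norm_ext0]); when pi is the left regular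
    representation of S_r, the family is the restricted left regular
    representation of S, extended by zero to l2(S_r) ([Lambda_norm_ext0]).

    An isometric *-homomorphism on a dense *-subalgebra extends to the completion
    ([isometric_extension]), and here the extension maps onto the range of
    [cut d]; composing it with the quotient map gives both isomorphisms.  The
    argument is the same for the two norms, so it is made once, for any two norms
    related by ext0 f |-> ext0 f - (sum f) delta_0
    ([completion_restricted_isomorphic]). *)

Set Implicit Arguments.
Unset Strict Implicit.
Unset Printing Implicit Defensive.

Import Order.TTheory GRing.Theory Num.Theory.
Import numFieldNormedType.Exports.

Local Open Scope classical_set_scope.
Local Open Scope ring_scope.

(** * Unordered sums *)

#[local] Existing Instance totally_filter.

Section UnorderedSums.
Context {K : numFieldType} {V : normedModType K}.

Definition fset_preim (I J : choiceType) (h : I -> J) (A : {fset J}) : {fset I} :=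
  fset_set (h @^-1` [set` A]).

Lemma in_fset_preim (I J : choiceType) (h : I -> J) (A : {fset J}) i :
  injective h -> (i \in fset_preim h A) = (h i \in A).
Proof.
move=> hI; have Afin : finite_set (h @^-1` [set` A]).
  by apply: finite_preimage => [x y _ _|]; [exact: hI|exact: finite_fset].
by rewrite in_fset_set//; apply/idP/idP => [/set_mem|/mem_set].
Qed.

(** Through this identity between filters, an unordered sum and its reindexing
    have literally the same net of partial sums, so that reindexing needs no
    convergence hypothesis. *)
Lemma totally_preim (I J : choiceType) (h : I -> J) : injective h ->
  fset_preim h @ totally = totally.
Proof.
move=> hI; apply/seteqP; split=> U [A _ AU].
- exists (fset_preim h A) => // B /= AB.
  have -> : B = fset_preim h (A `|` h @` B)%fset.
    apply/fsetP => i; rewrite in_fset_preim// in_fsetU mem_imfset//.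
    apply/idP/orP => [->|[hiA|//]]; first by right.
    by apply: (fsubsetP AB); rewrite in_fset_preim.
  by apply: AU => /=; exact: fsubsetUl.
- exists (h @` A)%fset => // B /= AB; apply: AU => /=.
  apply/fsubsetP => i iA; rewrite in_fset_preim//.
  by apply: (fsubsetP AB); rewrite mem_imfset.
Qed.

Lemma partial_sumE (I : choiceType) (F : I -> V) A :
  partial_sum F A = \sum_(i <- A) F i.
Proof. by rewrite /partial_sum big_seq_fsetE. Qed.

Lemma partial_sumD (I : choiceType) (F G : I -> V) A :
  partial_sum (fun i => F i + G i) A = partial_sum F A + partial_sum G A.
Proof. by rewrite !partial_sumE big_split. Qed.

Lemma partial_sum_reindex (I J : choiceType) (h : I -> J) (F : J -> V) :
  injective h -> (forall j, F j != 0 -> exists i, j = h i) ->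
  partial_sum F = partial_sum (F \o h) \o fset_preim h.
Proof.
move=> hI hF; apply/funext => A /=; rewrite !partial_sumE.
have -> : \sum_(i <- fset_preim h A) F (h i) =
    \sum_(j <- (h @` fset_preim h A)%fset) F j.
  by rewrite big_imfset//= => x y _ _; exact: hI.
apply/esym/big_fset_incl => [|j jA].
  by apply/fsubsetP => _ /imfsetP[i /= iA ->]; rewrite -in_fset_preim.
have [//|/hF[i ji]] := eqVneq (F j) 0.
by rewrite ji mem_imfset// in_fset_preim// -ji jA.
Qed.

Lemma cvg_sum_reindex (I J : choiceType) (h : I -> J) (F : J -> V) (v : V) :
  injective h -> (forall j, F j != 0 -> exists i, j = h i) ->
  partial_sum (F \o h) @ totally --> v -> partial_sum F @ totally --> v.
Proof.
move=> hI hF; rewrite (partial_sum_reindex hI hF).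
by rewrite -[in X in X -> _](totally_preim hI).
Qed.

Lemma sum_reindex (I J : choiceType) (h : I -> J) (F : J -> V) :
  injective h -> (forall j, F j != 0 -> exists i, j = h i) ->
  sum F = sum (F \o h).
Proof.
move=> hI hF; rewrite /sum (partial_sum_reindex hI hF).
by rewrite -[in RHS](totally_preim hI).
Qed.

Lemma cvg_sum_single (I : choiceType) (i0 : I) (v : V) :
  partial_sum (fun i => if i == i0 then v else 0) @ totally --> v.
Proof.
apply: cvg_near_cst; exists [fset i0]%fset => // A /= iA.
rewrite partial_sumE; apply/eqP.
have i0A : i0 \in A by rewrite (fsubsetP iA)// inE.
by rewrite (big_fsetD1 i0)//= eqxx big1_fset ?addr0// => i; rewrite !inE => /andP[/negbTE ->].
Qed.

(** Both nets of partial sums have the same limits, possibly none; in the latter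
    case both sums are the default point. *)
Lemma sum_add_null (I : choiceType) (F G : I -> V) :
  partial_sum G @ totally --> (0 : V) ->
  sum (fun i => F i + G i) = sum F.
Proof.
move=> G0; rewrite /sum /lim /lim_in.
congr get; apply/seteqP; split=> l /= Fl.
- have -> : partial_sum F = partial_sum (fun i => F i + G i) - partial_sum G.
    by apply/funext => A /=; rewrite fctE partial_sumD addrK.
  by rewrite -[l]subr0; exact: cvgB.
- have -> : partial_sum (fun i => F i + G i) = partial_sum F + partial_sum G.
    by apply/funext => A; rewrite partial_sumD.
  by rewrite -[l]addr0; exact: cvgD.
Qed.

End UnorderedSums.

(** * Completeness of the complex numbers and convergence of l1 sums *)

Section ComplexComplete.
Variable R : realType.

Lemma normci : `|'i%C : R[i]| = 1.
Proof. by rewrite normc_def/= expr0n expr1n add0r sqrtr1. Qed.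

Lemma normc_real (r : R) : `|r%:C%C : R[i]| = `|r|%:C%C.
Proof. by rewrite normc_def/= expr0n addr0 sqrtr_sqr. Qed.

Lemma normc_ge_Im (x : R[i]) : `|complex.Im x|%:C%C <= `|x|.
Proof.
apply: le_trans (_ : `|x * 'i%C| <= _); last by rewrite normrM normci mulr1.
by rewrite (le_trans _ (normc_ge_Re _))// ReiNIm normrN.
Qed.

Lemma complex_cauchy_cvg (F : set_system R[i]^o) :
  ProperFilter F -> cauchy F -> cvg F.
Proof.
move=> FF /cauchyP Fc.
have part (p : R[i] -> R) : (forall x y : R[i], p (x - y) = p x - p y) ->
    (forall x : R[i], `|p x|%:C%C <= `|x|) -> cvg (p @ F).
  move=> pB ple; apply: cauchy_cvg; apply/cauchyP => e e0.
  have e0C : 0 < e%:C%C by rewrite ltcR.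
  have [x Fx] := Fc _ e0C; exists (p x).
  suff : F [set y | ball (p x) e (p y)] by [].
  apply: filterS Fx => y; rewrite -!ball_normE /= -pB -ltcR => xy.
  exact: le_lt_trans (ple _) xy.
have /cvg_ex[a Fa] := part _ (@raddfB _ _ (@complex.Re R)) (@normc_ge_Re R).
have /cvg_ex[b Fb] := part _ (@raddfB _ _ (@complex.Im R)) normc_ge_Im.
apply/cvg_ex; exists (a +i* b)%C; apply/fcvgrPdist_lt => e e0.
have eE : e = (complex.Re e)%:C%C by rewrite RRe_real// gtr0_real.
move: e0; rewrite eE ltcR; set r := complex.Re e => r0.
have r20 : 0 < r / 2 by rewrite divr_gt0.
move/cvgrPdist_lt : Fa => /(_ _ r20) Fa.
move/cvgrPdist_lt : Fb => /(_ _ r20) Fb.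
near=> z.
have -> : ((a +i* b)%C : R[i]) - z =
    (a - complex.Re z)%:C%C + 'i%C * (b - complex.Im z)%:C%C.
  by rewrite [LHS]complexE; case: (z).
rewrite (le_lt_trans (ler_normD _ _))// normrM normci mul1r !normc_real.
rewrite -rmorphD ltcR [ltRHS]splitr ltrD//.
- by near: z; exact: Fa.
- by near: z; exact: Fb.
Unshelve. all: by end_near. Qed.

End ComplexComplete.

Section L1Sums.
Context {R : realType}.

Lemma big_fset_subset (V : nmodType) (I : choiceType) (A B : {fset I})
    (F : I -> V) : (A `<=` B)%fset ->
  \sum_(i <- B) F i = \sum_(i <- A) F i + \sum_(i <- (B `\` A)%fset) F i.
Proof.
move=> AB; rewrite (big_fsetID _ (fun i => i \in A)).
have -> : [fset i in B | i \in A]%fset = A.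
  apply/fsetP => i; rewrite !inE /=.
  by have [/(fsubsetP AB) ->|_] := boolP (i \in A); rewrite ?andbF.
have -> // : [fset i in B | i \notin A]%fset = (B `\` A)%fset.
by apply/fsetP => i; rewrite !inE /= andbC.
Qed.

(** The partial sums are Cauchy: once a finite set of indices carries the norm of
    f up to e, any finite sum over other indices is smaller than e. *)
Lemma l1_cvg (I : choiceType) (f : l1 R I) : cvg (partial_sum f @ totally).
Proof.
apply: complex_cauchy_cvg; apply/cauchyP => eps eps0.
have eE : eps = (complex.Re eps)%:C%C by rewrite RRe_real// gtr0_real.
move: eps0; rewrite {}eE ltcR; set e := complex.Re eps => e0.
have := l1_funP f; rewrite inE.
set M := (\esum_(x in setT) (rnorm (f x))%:E)%E => Mfin.
have M0 : (0 <= M)%E by apply: esum_ge0 => x _; rewrite lee_fin rnorm_ge0.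
have ME : M \is a fin_num by rewrite ge0_fin_numE.
have [_ [X [finX _] <-] XM] := ub_ereal_sup_adherent e0 ME.
exists (partial_sum f (fset_set X)); exists (fset_set X) => // B /= XB.
rewrite -ball_normE/= distrC -rnormE ltcR.
rewrite !partial_sumE (big_fset_subset _ XB) addrC addKr.
have : (\sum_(x <- fset_set X) (rnorm (f x))%:E +
    \sum_(x <- (B `\` fset_set X)%fset) (rnorm (f x))%:E <= M)%E.
  rewrite -(big_fset_subset (fun x => (rnorm (f x))%:E) XB); apply: esum_ge.
  by exists [set` B]; [split|rewrite fsbig_finite//= set_fsetK].
have {}XM : (M - e%:E < \sum_(x \in X) (rnorm (f x))%:E)%E by [].
move: XM; rewrite fsbig_finite//= -(fineK ME) !sumEFin -!EFinD lte_fin lee_fin.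
have : rnorm (\sum_(x <- (B `\` fset_set X)%fset) f x) <=
    \sum_(x <- (B `\` fset_set X)%fset) rnorm (f x).
  elim/big_ind2: _ => [|u r v s ur vs|//]; first by rewrite rnorm0.
  by rewrite (le_trans (rnormD _ _))// lerD.
lra.
Qed.

(** The terms added to G sum to (sum f) w - (sum f) w = 0, whether or not G is
    summable.  This is how subtracting (sum f) delta_0 turns a representation of
    S_r into the family s |-> pi s - pi 0. *)
Lemma sum_option_correction (V : normedModType R[i]) (S : choiceType)
    (f : l1 R S) (G : S -> V) (w : V) :
  sum (fun x : option S =>
    if x is Some s then G s + f s *: w else - (sum f *: w)) = sum G.
Proof.
(* The summand is F1 x + F2 x *: w, where the scalars F2 x sum to zero. *)
pose F1 (x : option S) := if x is Some s then G s else 0.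
pose Fs (x : option S) : R[i]^o := if x is Some s then f s else 0.
pose Fn (x : option S) : R[i]^o := if x == None then - sum f else 0.
pose F2 (x : option S) : R[i]^o := Fs x + Fn x.
rewrite (_ : (fun _ => _) = (fun x => F1 x + F2 x *: w)); last first.
  apply/funext => -[s|]; rewrite /F1 /F2 /Fs /Fn/= ?addr0//.
  by rewrite !add0r scaleNr.
have SI : injective (@Some S) by move=> x y [].
have SE (W : nmodType) (F : option S -> W) : F None = 0 ->
  forall x, F x != 0 -> exists s, x = Some s.
  by move=> F0 [s _|]; [exists s|rewrite F0 eqxx].
rewrite sum_add_null; first by rewrite (sum_reindex SI)//; exact: SE.
have -> : partial_sum (fun x => F2 x *: w) = (fun A => partial_sum F2 A *: w).
  by apply/funext => A; rewrite !partial_sumE -scaler_suml.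
rewrite -(scale0r w); apply: cvgZr_tmp.
have -> : partial_sum F2 = partial_sum Fs + partial_sum Fn.
  by apply/funext => A; rewrite partial_sumD.
rewrite -(subrr (sum f)); apply: cvgD; last exact: cvg_sum_single.
by apply: (cvg_sum_reindex SI); [exact: SE|exact: l1_cvg].
Qed.

End L1Sums.

(** * Extension of isometric star homomorphisms *)

Section GraphClosure.
Context {R : realType} {V : Type} {A B : normedModType R[i]}.
Implicit Types (e : V -> A) (g : V -> B).

(** The extension of the map e v |-> g v by continuity is built as the closure of
    its graph, because this relation is symmetric in e and g: one totality lemma
    yields both that the extension is defined everywhere and that its range is
    closed. *)
Definition graph_closure e g (a : A) (b : B) : Prop :=
  forall eps : R, 0 < eps ->
    exists v, rnorm (a - e v) < eps /\ rnorm (b - g v) < eps.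

Lemma rnorm_distC (W : normedModType R[i]) (u v : W) :
  rnorm (u - v) = rnorm (v - u).
Proof. by rewrite /rnorm distrC. Qed.

Lemma rnorm_dist_triangle (W : normedModType R[i]) (w u v : W) :
  rnorm (u - v) <= rnorm (u - w) + rnorm (w - v).
Proof. by rewrite (le_trans _ (rnormD _ _))// addrA subrK. Qed.

Lemma graph_closure_total e g a :
  (forall F : set_system B, ProperFilter F -> cauchy F -> cvg F) ->
  (forall v w, rnorm (g v - g w) <= rnorm (e v - e w)) ->
  (forall eps : R, 0 < eps -> exists v, rnorm (a - e v) < eps) ->
  exists b, graph_closure e g a b.
Proof.
move=> Bcomplete ge ea.
(* The images of the balls around a under the relation generate a Cauchy filter. *)
pose F : set_system B := filter_from [set r : R | 0 < r]
  (fun r => g @` [set v | rnorm (a - e v) < r]).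
have FF : ProperFilter F.
  apply: filter_from_proper; last first.
    by move=> r /= /ea[v av]; exists (g v), v.
  apply: filter_from_filter; first by exists 1 => /=.
  move=> r s /= r0 s0; exists (Num.min r s); first by rewrite /= lt_min r0.
  by move=> u [v /=]; rewrite lt_min => /andP[vr vs] <-; split; exists v.
have Fc : cauchy F.
  apply/cauchyP => eps eps0.
  have eE : eps = (complex.Re eps)%:C%C by rewrite RRe_real// gtr0_real.
  move: eps0; rewrite {}eE ltcR; set r := complex.Re eps => r0.
  have r20 : 0 < r / 2 by rewrite divr_gt0.
  have [v av] := ea _ r20; exists (g v); exists (r / 2) => //.
  move=> u [w /= aw <-]; rewrite -ball_normE/= -rnormE ltcR.
  apply: le_lt_trans (ge _ _) _; apply: le_lt_trans (rnorm_dist_triangle a _ _) _.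
  by rewrite [ltRHS]splitr ltrD// rnorm_distC.
have /cvg_ex[b Fb] := Bcomplete _ FF Fc.
exists b => eps eps0.
have bnbhs : nbhs b (ball b (eps%:C%C : R[i])).
  by apply: nbhsx_ballx; rewrite ltcR.
have [r /= r0 rb] := Fb _ bnbhs.
have [|v] := ea (Num.min r eps); first by rewrite lt_min r0.
rewrite lt_min => /andP[vr ve]; exists v; split=> //.
have /rb : (g @` [set v | rnorm (a - e v) < r]) (g v) by exists v.
by rewrite -ball_normE/= -rnormE ltcR.
Qed.

End GraphClosure.

Section LinearGraphClosure.
Context {R : realType} {V : lmodType R[i]} {A B : normedModType R[i]}.
Variables (e : {linear V -> A}) (g : {linear V -> B}).
Hypothesis ge : forall v, rnorm (g v) = rnorm (e v).

Lemma graph_closure_linear c a b a' b' :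
  graph_closure e g a b -> graph_closure e g a' b' ->
  graph_closure e g (c *: a + a') (c *: b + b').
Proof.
move=> ab ab' eps eps0.
have c0 : 0 <= complex.Re `|c| := rnorm_ge0 (c : R[i]^o).
pose r := eps / (complex.Re `|c| + 1).
have r0 : 0 < r by rewrite divr_gt0// ltr_wpDl.
have rE : complex.Re `|c| * r + r = eps.
  by rewrite -[X in _ + X]mul1r -mulrDl mulrC divfK// gt_eqF// ltr_wpDl.
have [v [av bv]] := ab _ r0; have [w [aw bw]] := ab' _ r0.
have split_diff (W : normedModType R[i]) (x x' y y' : W) :
    c *: x + x' - (c *: y + y') = c *: (x - y) + (x' - y').
  by rewrite opprD addrACA -scalerBr.
exists (c *: v + w); rewrite (linearP e) (linearP g) !split_diff.
by split; rewrite (le_lt_trans (rnormD _ _))// rnormZ -rE ler_ltD// ler_wpM2l// ltW.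
Qed.

Lemma graph_closure_norm a b : graph_closure e g a b -> rnorm b = rnorm a.
Proof.
move=> ab; apply/eqP; rewrite eq_le; apply/andP.
have tri (W : normedModType R[i]) (u v : W) : rnorm u <= rnorm (u - v) + rnorm v.
  by rewrite (le_trans _ (rnormD _ _))// subrK.
split; apply/ler_addgt0Pr => eps eps0.
- have [|v [av bv]] := ab (eps / 2); first by rewrite divr_gt0.
  have := tri _ b (g v); have := tri _ (e v) a; rewrite rnorm_distC ge; lra.
- have [|v [av bv]] := ab (eps / 2); first by rewrite divr_gt0.
  have := tri _ a (e v); have := tri _ (g v) b; rewrite (rnorm_distC (g v)) ge; lra.
Qed.

Lemma graph_closure_unique a b b' :
  graph_closure e g a b -> graph_closure e g a b' -> b = b'.
Proof.
move=> ab ab'; have := graph_closure_linear (-1) ab ab'.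
rewrite !scaleN1r addNr => /graph_closure_norm; rewrite rnorm0 => /rnorm0_eq0.
by rewrite addrC => /subr0_eq.
Qed.

End LinearGraphClosure.

(** * C-star algebra generalities *)

Section CstarFacts.
Context {R : realType} {A : cstarAlgebra R}.
Implicit Types a b c : A.

Lemma cstar_mulNr a b : cstar_mul a (- b) = - cstar_mul a b.
Proof. by rewrite -scaleN1r cstar_mulZr scaleN1r. Qed.

Lemma cstar_mulNl a b : cstar_mul (- a) b = - cstar_mul a b.
Proof. by rewrite -scaleN1r cstar_mulZl scaleN1r. Qed.

Lemma cstar_mulBr a b c : cstar_mul a (b - c) = cstar_mul a b - cstar_mul a c.
Proof. by rewrite cstar_mulDr cstar_mulNr. Qed.

Lemma cstar_mulBl a b c : cstar_mul (a - b) c = cstar_mul a c - cstar_mul b c.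
Proof. by rewrite cstar_mulDl cstar_mulNl. Qed.

Lemma cstar_mul0l a : cstar_mul 0 a = 0.
Proof. by have := cstar_mulBl 0 0 a; rewrite !subrr. Qed.

Lemma cstar_starB a b : cstar_star (a - b) = cstar_star a - cstar_star b.
Proof. by rewrite cstar_starD -scaleN1r cstar_starZ rmorphN1 scaleN1r. Qed.

Lemma rnorm_cstar_mul a b : rnorm (cstar_mul a b) <= rnorm a * rnorm b.
Proof. by rewrite -lecR rmorphM/= !rnormE cstar_normM. Qed.

Lemma rnorm_cstar_identity a :
  rnorm (cstar_mul (cstar_star a) a) = rnorm a ^+ 2.
Proof. by apply: complexI; rewrite rmorphXn/= !rnormE cstar_identity. Qed.

Lemma rnorm_star a : rnorm (cstar_star a) = rnorm a.
Proof.
have le_star b : rnorm b <= rnorm (cstar_star b).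
  have [->|b0] := eqVneq (rnorm b) 0; first exact: rnorm_ge0.
  rewrite -(ler_pM2r (x := rnorm b)) ?lt_def ?b0 ?rnorm_ge0//.
  by rewrite -expr2 -rnorm_cstar_identity rnorm_cstar_mul.
by apply/eqP; rewrite eq_le le_star -{2}(cstar_starK a) le_star.
Qed.

End CstarFacts.

(** If x > y, the powers of x / y are unbounded, by the Bernoulli inequality. *)
Lemma le_of_expn_le (R : realType) (K x y : R) : 0 <= x -> 0 <= y ->
  (forall n, x ^+ (2 ^ n) <= K * y ^+ (2 ^ n)) -> x <= y.
Proof.
move=> x0 y0 xy; rewrite leNgt; apply/negP => yx.
have [y00|yn0] := eqVneq y 0.
  by have := xy 0%N; rewrite y00 !expr1 mulr0 leNgt -y00 yx.
have {yn0}y0 : 0 < y by rewrite lt_def yn0.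
set t := x / y - 1.
have t0 : 0 < t by rewrite subr_gt0 ltr_pdivlMr// mul1r.
have bernoulli m : 1 + m%:R * t <= (x / y) ^+ m.
  elim: m => [|m IH]; first by rewrite mul0r addr0 expr0.
  have xyE : x / y = 1 + t by rewrite /t addrC subrK.
  have m0 : 0 <= m%:R * t ^+ 2 by rewrite mulr_ge0// sqr_ge0.
  rewrite exprSr; apply: le_trans (_ : (1 + m%:R * t) * (x / y) <= _).
    by rewrite xyE -natr1; nra.
  by rewrite ler_wpM2r// xyE addr_ge0// ltW.
(* The exponent exceeds K / t because 2 ^ n > n. *)
pose n := Num.Def.truncn (K / t).
have Kn : K < (2 ^ n)%:R * t.
  rewrite -ltr_pdivrMr//.
  have [K0|K0] := ltP (K / t) 0; first by rewrite (lt_le_trans K0).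
  apply: lt_le_trans (_ : n.+1%:R <= _).
    by have /andP[_] := truncn_itv K0.
  by rewrite ler_nat ltn_expl.
have := bernoulli (2 ^ n)%N; rewrite expr_div_n ler_pdivlMr ?exprn_gt0//.
move=> /le_trans/(_ (xy n)); rewrite ler_pM2r ?exprn_gt0//; lra.
Qed.

(** By the C-star identity, a bound K on the norm of L gives
    |L a|^(2^n) <= K |a|^(2^n) for every n, and the influence of K vanishes on
    taking roots. *)
Lemma bounded_starhom_contractive (R : realType) (A B : cstarAlgebra R)
    (L : A -> B) (K : R) :
  (forall a, L (cstar_mul (cstar_star a) a) = cstar_mul (cstar_star (L a)) (L a)) ->
  (forall a, rnorm (L a) <= K * rnorm a) ->
  forall a, rnorm (L a) <= rnorm a.
Proof.
move=> Lsq LK a; apply: (@le_of_expn_le _ K); rewrite ?rnorm_ge0// => n.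
elim: n a => [|n IH] a; first by rewrite !expr1.
by rewrite expnS !exprM -!rnorm_cstar_identity -Lsq.
Qed.

Lemma dense_approx (R : realType) (W : normedModType R[i]) (D : set W) :
  dense D -> forall (a : W) (eps : R), 0 < eps -> exists2 b, D b & rnorm (a - b) < eps.
Proof.
move=> Dd a eps eps0.
have e0 : 0 < (eps%:C%C : R[i]) by rewrite ltcR.
have [|b [ab Db]] := Dd (ball a (eps%:C%C : R[i])) _ (ball_open a _).
  by exists a; exact: ballxx.
by exists b => //; rewrite -ltcR rnormE; move: ab; rewrite -ball_normE.
Qed.

(** Bundles a function whose linearity is established only inside a proof. *)
Lemma linear_of (K : pzRingType) (U W : lmodType K) (f : U -> W) :
  linear f -> exists L : {linear U -> W}, L =1 f.
Proof.
move=> fl; pose isL := GRing.isLinear.Build K U W *:%R f fl.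
by pose L : {linear U -> W} := HB.pack f isL; exists L.
Qed.

Section IsometricExtension.
Context {R : realType} {A0 : normedStarAlgebra R} (A : cstarCompletion A0).
Context {B : cstarAlgebra R}.
Variable g : {linear A0 -> (B : completeNormedModType R[i])}.
Hypothesis gM : {morph g : f h / nsa_mul f h >-> cstar_mul f h}.
Hypothesis gstar : {morph g : f / nsa_star f >-> cstar_star f}.
Hypothesis gnorm : forall f, rnorm (g f) = nsa_norm f.

Local Notation emb := (completion_emb A).
Local Notation graph := (graph_closure emb g).

Lemma emb_approx (a : A) (eps : R) : 0 < eps ->
  exists f, rnorm (a - emb f) < eps.
Proof.
move=> /(dense_approx (@completion_emb_dense _ _ A) a)[_ [f _ <-] af].
by exists f.
Qed.

Lemma g_isometric f : rnorm (g f) = rnorm (emb f).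
Proof. by rewrite gnorm completion_emb_norm. Qed.

Lemma graph_mul a b a' b' : graph a b -> graph a' b' ->
  graph (cstar_mul a a') (cstar_mul b b').
Proof.
move=> ab ab' eps eps0.
have bound (W : cstarAlgebra R) (M r : R) (u v u' v' : W) :
    rnorm u <= M -> rnorm v' <= M -> rnorm (u - v) < r ->
    rnorm (u' - v') < r -> rnorm (cstar_mul u u' - cstar_mul v v') <= (M + M) * r.
  move=> uM vM uv uv'.
  apply: le_trans (rnorm_dist_triangle (cstar_mul u v') _ _) _.
  rewrite -cstar_mulBr -cstar_mulBl mulrDl lerD//.
    by rewrite (le_trans (rnorm_cstar_mul _ _))// ler_pM ?rnorm_ge0// ltW.
  by rewrite (le_trans (rnorm_cstar_mul _ _))// mulrC ler_pM ?rnorm_ge0// ltW.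
(* M bounds rnorm a and, once w approximates a' to within r <= 1, also emb w. *)
pose M := rnorm a + rnorm a' + 1.
have a0 := rnorm_ge0 a; have a0' := rnorm_ge0 a'.
have M0 : 0 < M by rewrite /M; lra.
have M30 : 0 < M + M + M by exact: addr_gt0 (addr_gt0 M0 M0) M0.
pose r := Num.min 1 (eps / (M + M + M)).
have r0 : 0 < r by rewrite lt_min ltr01 divr_gt0.
have rM : (M + M) * r < eps.
  apply: lt_le_trans (_ : (M + M + M) * r <= _).
    by rewrite ltr_pM2r// ltrDl.
  by rewrite mulrC -ler_pdivlMr// ge_min lexx orbT.
have r1 : r <= 1 by rewrite ge_min lexx.
have [v [av bv]] := ab _ r0; have [w [aw bw]] := ab' _ r0.
have wM : rnorm (emb w) <= M.
  have := rnorm_dist_triangle a' (emb w) 0; rewrite !subr0 (rnorm_distC (emb w)).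
  rewrite /M; lra.
exists (nsa_mul v w); rewrite completion_embM gM; split.
- by apply: le_lt_trans rM; apply: bound => //; rewrite /M; lra.
- apply: le_lt_trans rM; apply: bound => //; last by rewrite g_isometric.
  by rewrite (graph_closure_norm g_isometric ab) /M; lra.
Qed.

Lemma graph_star a b : graph a b -> graph (cstar_star a) (cstar_star b).
Proof.
move=> ab eps /ab[f [af bf]]; exists (nsa_star f).
by rewrite completion_emb_star gstar -!cstar_starB !rnorm_star.
Qed.

(** The last clause says that the range of the extension is the whole closure of
    the range of g, the source being complete. *)
Theorem isometric_extension : exists Psi : {linear A -> B},
  [/\ {morph Psi : a b / cstar_mul a b},
      {morph Psi : a / cstar_star a},
      forall a, rnorm (Psi a) = rnorm a,
      forall f, Psi (emb f) = g f &
      forall b, (forall eps : R, 0 < eps -> exists f, rnorm (b - g f) < eps) ->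
        exists a, Psi a = b].
Proof.
have total a : exists b, graph a b.
  apply: graph_closure_total; [exact: cauchy_cvg| |exact: emb_approx].
  by move=> v w; rewrite -!linearB g_isometric.
have [Psi PsiP] := choice total.
have PsiE a b : graph a b -> Psi a = b.
  exact: (graph_closure_unique g_isometric (PsiP a)).
have [|L LE] := @linear_of _ _ _ Psi.
  by move=> c a a'; apply: PsiE; exact: graph_closure_linear.
exists L; split=> [a b|a|a|f|b bg]; rewrite ?LE.
- by apply: PsiE; exact: graph_mul.
- by apply: PsiE; exact: graph_star.
- by rewrite (graph_closure_norm g_isometric (PsiP a)).
- by apply: PsiE => eps eps0; exists f; rewrite !subrr !rnorm0.
- have [|a ba] := graph_closure_total (e := g) (g := emb) (@cauchy_cvg A) _ bg.
    by move=> v w; rewrite -!linearB g_isometric.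
  exists a; rewrite LE; apply: PsiE => eps /ba[f [bf af]].
  by exists f.
Qed.

End IsometricExtension.

(** * Quotient by a central projection *)

Section CentralProjection.
Context {R : realType} {A : cstarAlgebra R}.
Variable d : A.
Hypothesis d_star : cstar_star d = d.
Hypothesis d_idem : cstar_mul d d = d.
Hypothesis d_central : forall a, cstar_mul a d = cstar_mul d a.
Implicit Types a b : A.

(** Multiplication by 1 - d, in an algebra that need not have a unit. *)
Definition cut a : A := a - cstar_mul a d.

Lemma cut_linear : linear cut.
Proof.
move=> c a b; rewrite /cut cstar_mulDl cstar_mulZl opprD addrACA.
by rewrite -scalerBr.
Qed.

Lemma cut_mul_d a : cstar_mul (cut a) d = 0.
Proof. by rewrite cstar_mulBl -cstar_mulA d_idem subrr. Qed.

Lemma cutM a b : cut (cstar_mul a b) = cstar_mul (cut a) (cut b).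
Proof.
rewrite [RHS]cstar_mulBr (d_central b) cstar_mulA cut_mul_d.
rewrite cstar_mul0l subr0 cstar_mulBl /cut; congr (_ - _).
by rewrite -!cstar_mulA d_central.
Qed.

Lemma cut_star a : cut (cstar_star a) = cstar_star (cut a).
Proof. by rewrite /cut cstar_starB cstar_starM d_star d_central. Qed.

Lemma cut_line c : cut (c *: d) = 0.
Proof. by rewrite /cut cstar_mulZl d_idem subrr. Qed.

Lemma cut_self : cut d = 0.
Proof. by rewrite /cut d_idem subrr. Qed.

Lemma cut_id a : cstar_mul a d = 0 -> cut a = a.
Proof. by rewrite /cut => ->; rewrite subr0. Qed.

Lemma rnorm_cut_le a : rnorm (cut a) <= rnorm a.
Proof.
apply: (@bounded_starhom_contractive _ _ _ cut (1 + rnorm d)) => {}a.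
  by rewrite cutM cut_star.
rewrite mulrDl mul1r mulrC (le_trans (rnormD _ _))// lerD2l.
by rewrite /rnorm normrN; exact: rnorm_cstar_mul.
Qed.

(** A projection has norm 0 or 1; in the latter case c |-> c d is an isometry on
    the complete space of complex numbers, so its range is closed. *)
Lemma line_closed a :
  (forall eps : R, 0 < eps -> exists c : R[i], rnorm (a - c *: d) < eps) ->
  exists c : R[i], a = c *: d.
Proof.
move=> ad.
have [d0|dn0] := eqVneq (rnorm d) 0.
  exists 0; rewrite scale0r; apply: rnorm0_eq0; apply/eqP.
  rewrite eq_le rnorm_ge0 andbT; apply/ler_addgt0Pr => eps /ad[c].
  by rewrite (rnorm0_eq0 d0) scaler0 subr0 add0r => /ltW.
have d1 : rnorm d = 1.
  apply: (mulIf dn0); rewrite mul1r -expr2 -rnorm_cstar_identity.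
  by rewrite d_star d_idem.
pose e (c : R[i]^o) : A := c *: d; pose g (c : R[i]^o) : R[i]^o := c.
have [|c ac] := graph_closure_total (e := e) (g := g) (@complex_cauchy_cvg R) _ ad.
  by move=> v w; rewrite /e -scalerBl rnormZ d1 mulr1.
exists c; apply/eqP; rewrite -subr_eq0; apply/eqP/rnorm0_eq0/eqP.
rewrite eq_le rnorm_ge0 andbT; apply/ler_addgt0Pr => eps eps0; rewrite add0r.
have [|v [av cv]] := ac (eps / 2); first by rewrite divr_gt0.
rewrite (le_trans (rnorm_dist_triangle (v *: d) _ _))// [leRHS]splitr.
rewrite lerD//; first exact: ltW.
by rewrite -scalerBl rnormZ d1 mulr1; move: cv; rewrite rnorm_distC => /ltW.
Qed.

End CentralProjection.

Section LineQuotient.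
Context {R : realType} {A B : cstarAlgebra R}.
Variable d : A.
Hypothesis d_star : cstar_star d = d.
Hypothesis d_idem : cstar_mul d d = d.
Hypothesis d_central : forall a, cstar_mul a d = cstar_mul d a.
Hypothesis d_ideal : forall a, exists c : R[i], cstar_mul a d = c *: d.

Variable Psi : {linear B -> A}.
Hypothesis PsiM : {morph Psi : a b / cstar_mul a b}.
Hypothesis Psi_star : {morph Psi : a / cstar_star a}.
Hypothesis Psi_norm : forall b, rnorm (Psi b) = rnorm b.
Hypothesis Psi_d : forall b, cstar_mul (Psi b) d = 0.
Hypothesis Psi_onto : forall a, exists b, Psi b = cut d a.

Local Open Scope quotient_scope.
Local Notation Q := {ideal_quot (line (d : nsa_of_cstar A))}.
Local Notation pi := (\pi_Q).

Lemma pi_eqP (a b : A) : pi a = pi b <-> exists c : R[i], a - b = c *: d.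
Proof.
split=> [/eqP|[c ab]]; first by rewrite -Quotient.idealrBE => /asboolP.
by apply/eqP; rewrite -Quotient.idealrBE; apply/asboolP; exists c.
Qed.

Lemma pi_eq_cut a b : pi a = pi b -> cut d a = cut d b.
Proof.
move=> /pi_eqP[c ab]; apply/eqP; rewrite -subr_eq0; apply/eqP.
have <- : cut d (a - b) = cut d a - cut d b.
  by have := cut_linear d (-1) b a; rewrite !scaleN1r ![- _ + _]addrC.
by rewrite ab cut_line.
Qed.

Lemma pi_cutK a : pi (cut d a) = pi a.
Proof.
apply/pi_eqP; have [c ac] := d_ideal a; exists (- c).
by rewrite /cut ac addrAC subrr add0r scaleNr.
Qed.

Lemma cut_Psi b : cut d (Psi b) = Psi b.
Proof. exact: cut_id. Qed.

(** Every coset of C d contains exactly one element of the range of [cut d],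
    which is also the range of Psi, and this element has the least norm in its
    coset because [cut d] is contractive and constant on cosets. *)
Theorem line_quotient_isomorphic :
  isometrically_isomorphic B (line_quotient A d).
Proof.
pose phi (b : nsa_of_cstar B) : line_quotient A d := pi (Psi b).
have phi_linear : linear phi.
  move=> c b b'; rewrite /phi linearP quot_piD; congr (_ + _).
  exact: esym (@quot_scaleE R A d c (Psi b)).
have [L LE] := linear_of phi_linear.
have L_norm b : nsa_norm (L b) = rnorm b.
  rewrite LE -Psi_norm /phi /=; set N := [set _ | _ in _].
  have NPsi : N (rnorm (Psi b)) by exists (Psi b).
  have lbN : lbound N (rnorm (Psi b)).
    move=> _ [a /= /pi_eq_cut ab <-].
    by rewrite -cut_Psi -ab rnorm_cut_le.
  apply/eqP; rewrite eq_le ge_inf//=; last by exists (rnorm (Psi b)).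
  by rewrite lb_le_inf//; exists (rnorm (Psi b)).
have cut_repr a : cut d (repr (pi a)) = cut d a by apply: pi_eq_cut; rewrite reprK.
exists L; split=> //.
- rewrite -setTT_bijective; split=> //.
  + move=> b b' _ _ bb'; apply/subr0_eq/rnorm0_eq0.
    rewrite -L_norm linearB bb' subrr -(linear0 L) L_norm; exact: rnorm0.
  + move=> q _; have [b ba] := Psi_onto (repr (q : Q)).
    by exists b => //; rewrite LE /phi ba pi_cutK reprK.
- move=> b b'; rewrite !LE /phi /= PsiM -[LHS]pi_cutK -[RHS]pi_cutK.
  by rewrite !cutM// !cut_repr.
- move=> b; rewrite !LE /phi /= Psi_star -[LHS]pi_cutK -[RHS]pi_cutK.
  by rewrite !cut_star// cut_repr.
Qed.

End LineQuotient.

(** * The algebra l1(S_r) and the point mass at zero *)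

Section RestrictedL1.
Context {R : realType} {S : inverseSemigroupType}.
Local Notation Sr := (restricted S).
Local Notation l1S := (l1 R S).
Local Notation l1T := (l1 R Sr).
Local Notation d0 := (delta0 R S).

Lemma esum_restricted (a : Sr -> \bar R) : a None = 0%E ->
  (\esum_(x in [set: Sr]) a x = \esum_(s in [set: S]) a (Some s))%E.
Proof.
move=> a0; rewrite -(@esum_image _ _ _ setT (@Some S : S -> Sr) a); last first.
  by move=> x y _ _ [].
rewrite [RHS]esum_mkcond; apply: eq_esum => -[s|] _.
  by rewrite mem_set//; exists s.
by case: ifP.
Qed.

Lemma ext0_l1 (f : l1S) :
  (fun x : Sr => if x is Some s then f s else 0) \in @l1_pred R Sr.
Proof.
rewrite inE esum_restricted ?rnorm0//.
by have := l1_funP f; rewrite inE.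
Qed.

Definition ext0 f : l1T := L1 (ext0_l1 f).

Lemma restrict_l1 (f : l1T) : (fun s => f (Some s)) \in @l1_pred R S.
Proof.
rewrite inE; apply: le_lt_trans (l1_funP f).
apply: (esum_inj_le (h := @Some S : S -> Sr) (a := fun x => (rnorm (f x))%:E)).
  by move=> x; rewrite lee_fin rnorm_ge0.
by move=> x y _ _ [].
Qed.

Definition restrict f : l1S := L1 (restrict_l1 f).

Lemma l1_ext (T : choiceType) (f g : l1 R T) : (forall x, f x = g x) -> f = g.
Proof. by move=> fg; apply/val_inj/funext. Qed.

Lemma ext0_linear : linear ext0.
Proof.
move=> c f g; apply: l1_ext => -[s|]//.
by apply: esym; apply: etrans (addr0 _) _; exact: mulr0.
Qed.

Lemma ext0_restrict f : f = ext0 (restrict f) + f None *: d0.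
Proof.
apply: l1_ext => -[s|].
  by apply: etrans (esym (addr0 _)) _; congr (_ + _); rewrite [RHS]mulr0.
by apply: etrans (esym (add0r _)) _; congr (_ + _); rewrite [RHS]mulr1.
Qed.

Lemma ext0_star f : ext0 (l1_star f) = l1_star (ext0 f).
Proof. by apply: l1_ext => -[s|]//=; rewrite conjC0. Qed.

Lemma delta0_star : l1_star d0 = d0.
Proof. by apply: l1_ext => -[s|]/=; rewrite ?conjC0 ?conjC1. Qed.

Lemma sum0 (T : choiceType) : sum (fun _ : T => 0 : R[i]^o) = 0.
Proof.
apply: cvg_lim => //; apply: cvg_near_cst; apply: nearW => A.
by rewrite partial_sumE big1.
Qed.

Lemma sum_delta0 : sum d0 = 1.
Proof.
apply: cvg_lim => //.
have -> : (d0 : Sr -> R[i]^o) = (fun x => if x == None then 1 else 0).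
  by apply/funext => -[s|].
exact: cvg_sum_single.
Qed.

Lemma conv_delta0 f : l1_conv f d0 = sum f *: d0.
Proof.
apply: l1_ext => x.
transitivity (sum (fun y : Sr => (if None == x then f y else 0) : R[i]^o)).
  rewrite [LHS](@sum_reindex _ _ _ _ (fun y : Sr => (y, None : Sr))).
  - by congr sum; apply/funext => -[s|]/=; rewrite mulr1.
  - by move=> y z [].
  - move=> [y [s|]]/=; first by rewrite mulr0 if_same eqxx.
    by exists y.
by case: x => [s|] /=; rewrite ?sum0; [rewrite [RHS]mulr0|rewrite [RHS]mulr1].
Qed.

Lemma delta0_conv f : l1_conv d0 f = sum f *: d0.
Proof.
apply: l1_ext => x.
transitivity (sum (fun y : Sr => (if None == x then f y else 0) : R[i]^o)).
  rewrite [LHS](@sum_reindex _ _ _ _ (fun y : Sr => (None : Sr, y))).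
  - by congr sum; apply/funext => -[s|]/=; rewrite mul1r.
  - by move=> y z [].
  - move=> [[s|] y]/=; first by rewrite mul0r if_same eqxx.
    by exists y.
by case: x => [s|] /=; rewrite ?sum0; [rewrite [RHS]mulr0|rewrite [RHS]mulr1].
Qed.

(** The right-hand side is the range of summation in the restricted product, and
    the left-hand side says that the pair (u y, y star) contributes to the value at u
    of a convolution over S_r; [conv_ext0] matches the two sums along this
    correspondence. *)
Lemma restricted_factorization (u y : S) :
  ((Some (u * y)%g : Sr) * Some (star y) == Some u)%g =
  (y * star y == star u * u)%g.
Proof.
rewrite -[X in X == _]/(restricted_mul (Some (u * y)%g) (Some (star y))).
rewrite /restricted_mul starK starM.
apply/idP/eqP => [|yu].
  case: ifP => // /eqP E1 /eqP[E2].
  (* Each of the two idempotents y (star y) and (star u) u is below the other. *)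
  have uy : (star u * u * (y * star y) = star u * u)%g.
    by rewrite -!mulgA (mulgA u) E2.
  transitivity (y * (star y * y) * star y)%g.
    by rewrite !mulgA mulg_star_mulg.
  rewrite -E1.
  transitivity (y * star y * (star u * u) * (y * star y))%g; first by rewrite !mulgA.
  rewrite -mulgA uy (idemC (idem_mul_star y) (idem_star_mul u)).
  exact: uy.
have -> : (star y * star u * (u * y) = star y * y)%g.
  by rewrite !mulgA -(mulgA (star y)) -yu !mulgA star_mulg_star.
by rewrite eqxx -mulgA yu mulgA mulg_star_mulg.
Qed.

Lemma conv_ext0 f g u : l1_conv (ext0 f) (ext0 g) (Some u) = l1_rconv f g u.
Proof.
rewrite [LHS](@sum_reindex _ _ _ _
  (fun y => (Some (u * y)%g : Sr, Some (star y) : Sr))).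
- by congr sum; apply/funext => y /=; rewrite restricted_factorization.
- by move=> y z [_ yz]; rewrite -(starK y) yz starK.
- move=> [[a|] [b|]]/=; rewrite ?mul0r ?mulr0 ?if_same ?eqxx //.
  case: ifP => [|_]; last by rewrite eqxx.
  rewrite -[X in X == _]/(restricted_mul (Some a) (Some b)) /restricted_mul.
  case: ifP => // /eqP ab /eqP[<-] _; exists (star b).
  by rewrite -mulgA -ab mulgA mulg_star_mulg starK.
Qed.

End RestrictedL1.

(** * Comparison of the norms *)

Section RepresentationNorms.
Context {R : realType} {S : inverseSemigroupType}.
Local Notation Sr := (restricted S).
Implicit Types f : l1 R S.

Lemma rep_ext_correction (V : normedModType R[i]) (pi : Sr -> V -> V) f v :
  rep_ext pi (ext0 f - sum f *: delta0 R S) v =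
  sum (fun s => f s *: (pi (Some s) v - pi None v)).
Proof.
rewrite -(sum_option_correction f _ (pi None v)) /rep_ext.
congr sum; apply/funext => -[s|].
  rewrite -scalerDr subrK; congr (_ *: _).
  by transitivity (f s - sum f * 0); last by rewrite mulr0 subr0.
apply: etrans (scaleNr _ _); congr (_ *: _).
by transitivity (0 - sum f * 1); last by rewrite mulr1 sub0r.
Qed.

Section Sigma.
Variable H : hilbertSpace R.

(** The vectors p v and v - p v are orthogonal. *)
Lemma sub_projection_contraction (p : H -> H) v :
  (forall u w, inner H (p u) w = inner H u (p w)) ->
  (forall w, p (p w) = p w) ->
  `|v - p v| <= `|v|.
Proof.
move=> padj pp.
have vp : inner H v (p v) = inner H (p v) (p v) by rewrite padj pp.
have pv : inner H (p v) v = inner H (p v) (p v) by rewrite [RHS]padj pp -padj.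
rewrite -(ler_pXn2r (n := 2)) ?nnegrE// !inner_norm.
rewrite linearBl !linearBr /= vp pv subrr subr0 lerBlDr lerDl.
by rewrite -inner_norm exprn_ge0.
Qed.

(** As 0 absorbs in S_r, the operator pi 0 is a projection that absorbs every
    pi x; so pi s - pi 0 is pi s cut down to the kernel of pi 0, where products
    that are 0 in S_r act as 0. *)
Lemma restricted_of_representation (pi : Sr -> {linear H -> H}) :
  representation pi ->
  restricted_representation
    (fun s => (pi (Some s) \- pi None : {linear H -> H})).
Proof.
move=> [pc pa pm].
have p0r x v : pi x (pi None v) = pi None v.
  by rewrite pm; congr (pi _ _); case: x.
have p0l x v : pi None (pi x v) = pi None v by rewrite pm.
have pE x v : pi x v - pi None v = pi x (v - pi None v) by rewrite linearB p0r.
have piM (x y : Sr) v : pi x (pi y v - pi None v) -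
    pi None (pi y v - pi None v) = pi (x * y)%g v - pi None v.
  by rewrite (linearB (pi x)) (linearB (pi None)) !p0r p0l subrr subr0 pm.
split=> /=.
- move=> x v; rewrite pE (le_trans (pc _ _))//.
  apply: sub_projection_contraction => [u w|w]; last exact: p0l.
  exact: (pa None).
- move=> x u v; rewrite linearBl linearBr.
  by congr (_ - _); [exact: (pa (Some x))|exact: (pa None)].
- move=> x y v xy; rewrite piM; congr (pi _ _ - _).
  rewrite -[LHS]/(restricted_mul (Some x) (Some y)) /restricted_mul.
  by rewrite xy eqxx.
- move=> x y v /eqP/negbTE xy; rewrite piM.
  rewrite -[(_ * _)%g]/(restricted_mul (Some x) (Some y)) /restricted_mul.
  by rewrite xy subrr.
Qed.

Lemma representation_of_restricted (sigma : S -> {linear H -> H}) :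
  restricted_representation sigma ->
  representation (fun x : Sr => if x is Some s then sigma s else (\0 : {linear H -> H})).
Proof.
move=> [sc sa sm sm0]; split=> [[s|] v|[s|] u v|[s|] [t|] v] //=; rewrite ?linear0 ?normr0 ?linear0l ?linear0r//.
rewrite -[(_ * _)%g]/(restricted_mul (Some s) (Some t)) /restricted_mul.
by case: eqP => [/sm ->|/sm0 ->].
Qed.

End Sigma.

Lemma Sigma_norm_ext0 f :
  Sigma_norm (ext0 f - sum f *: delta0 R S) = Sigma_r_norm f.
Proof.
rewrite /Sigma_norm /Sigma_r_norm; congr sup; apply/seteqP; split.
- move=> r [H [pi [piP ->]]].
  exists H, (fun s => (pi (Some s) \- pi None : {linear H -> H})).
  split; first exact: restricted_of_representation.
  by congr opnorm; apply/funext => v; rewrite rep_ext_correction.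
- move=> r [H [sigma [sigmaP ->]]].
  exists H; eexists; split; first exact: representation_of_restricted sigmaP.
  congr opnorm; apply/funext => v; rewrite rep_ext_correction /rep_ext.
  by congr sum; apply/funext => s /=; rewrite subr0.
Qed.

Lemma l2_ext (T : choiceType) (f g : l2 R T) : (forall x, f x = g x) -> f = g.
Proof. by move=> fg; apply/val_inj/funext. Qed.

Lemma ext0_l2 (xi : l2 R S) :
  (fun x : Sr => if x is Some s then xi s else 0) \in @l2_pred R Sr.
Proof.
rewrite inE esum_restricted ?rnorm0 ?expr0n//.
by have := l2_funP xi; rewrite inE.
Qed.

Definition l2_ext0 xi : l2 R Sr := L2 (ext0_l2 xi).

Lemma restrict_l2 (xi : l2 R Sr) : (fun s => xi (Some s)) \in @l2_pred R S.
Proof.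
rewrite inE; apply: le_lt_trans (l2_funP xi).
apply: (esum_inj_le (h := @Some S : S -> Sr) (a := fun x => (rnorm (xi x) ^+ 2)%:E)).
  by move=> x; rewrite lee_fin sqr_ge0.
by move=> x y _ _ [].
Qed.

Definition l2_restrict xi : l2 R S := L2 (restrict_l2 xi).

Lemma l2_ext0K : cancel l2_ext0 l2_restrict.
Proof. by move=> xi; apply: l2_ext. Qed.

Lemma l2_ext0_linear : linear l2_ext0.
Proof.
move=> c f g; apply: l2_ext => -[s|]//.
by apply: esym; apply: etrans (addr0 _) _; exact: mulr0.
Qed.

Lemma l2_restrict_linear : linear l2_restrict.
Proof. by move=> c f g; apply: l2_ext. Qed.

Lemma rnorm_l2 (T : choiceType) (xi : l2 R T) : rnorm xi = l2_norm xi.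
Proof. by []. Qed.

Lemma rnorm_l2_ext0 xi : rnorm (l2_ext0 xi) = rnorm xi.
Proof.
by rewrite !rnorm_l2 /l2_norm esum_restricted//= rnorm0 expr0n.
Qed.

Lemma rnorm_l2_restrict_le xi : rnorm (l2_restrict xi) <= rnorm xi.
Proof.
have pos (T : choiceType) (eta : l2 R T) :
    (0 <= \esum_(x in setT) (rnorm (eta x) ^+ 2)%:E)%E.
  by apply: esum_ge0 => x _; rewrite lee_fin sqr_ge0.
have fin (T : choiceType) (eta : l2 R T) :
    (\esum_(x in setT) (rnorm (eta x) ^+ 2)%:E)%E \is a fin_num.
  by rewrite ge0_fin_numE//; have := l2_funP eta; rewrite inE.
rewrite !rnorm_l2 ler_wsqrtr// fine_le//.
apply: (esum_inj_le (h := @Some S : S -> Sr) (a := fun x => (rnorm (xi x) ^+ 2)%:E)).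
  by move=> x; rewrite lee_fin sqr_ge0.
by move=> x y _ _ [].
Qed.

(** Extension by zero has a continuous left inverse, so a family in l2(S) is
    summable exactly when its extension is, and completeness of l2(S) does not
    enter; a divergent sum is 0 by convention on both sides. *)
Lemma sum_l2_ext0 (I : choiceType) (F : I -> l2 R S) :
  sum (fun i => l2_ext0 (F i)) = l2_ext0 (sum F).
Proof.
have [iota iotaE] := linear_of l2_ext0_linear.
have [rho rhoE] := linear_of l2_restrict_linear.
have bounded_cvg (V W : normedModType R[i]) (L : {linear V -> W})
    (P : {fset I} -> V) l : (forall v, rnorm (L v) <= rnorm v) ->
    P @ totally --> l -> (L \o P) @ totally --> L l.
  move=> Lle /cvgrPdist_lt Pl; apply/cvgrPdist_lt => e /Pl.
  apply: filterS => A /=; apply: le_lt_trans.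
  by rewrite -linearB -!rnormE lecR.
have sumE : partial_sum (fun i => l2_ext0 (F i)) = iota \o partial_sum F.
  apply/funext => A /=; rewrite !partial_sumE linear_sum.
  by apply: eq_bigr => i _; rewrite iotaE.
have iota_le v : rnorm (iota v) <= rnorm v by rewrite iotaE rnorm_l2_ext0.
have rho_le v : rnorm (rho v) <= rnorm v by rewrite rhoE rnorm_l2_restrict_le.
rewrite /sum sumE -iotaE.
have [/cvg_ex[l Fl]|Fdv] := pselect (cvg (partial_sum F @ totally)).
  rewrite (cvg_lim _ Fl)//; apply: cvg_lim => //; exact: bounded_cvg.
have Gdv : ~ cvg ((iota \o partial_sum F) @ totally).
  move=> /cvg_ex[l Gl]; apply: Fdv; apply/cvg_ex; exists (rho l).
  have -> : partial_sum F = rho \o (iota \o partial_sum F).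
    by apply/funext => A; rewrite /= iotaE rhoE l2_ext0K.
  exact: bounded_cvg.
rewrite (dvgP Fdv) (dvgP Gdv).
have -> : point = 0 :> l2 R S by [].
by rewrite linear0.
Qed.

Lemma restricted_range_some (t : S) :
  ((Some t : Sr) * star (Some t : Sr))%g = Some (t * star t)%g.
Proof.
rewrite -[LHS]/(restricted_mul (Some t) (Some (star t))) /restricted_mul.
by rewrite starK eqxx.
Qed.

Lemma restricted_idem_le (s t : S) :
  idem_le ((Some t : Sr) * star (Some t : Sr))%g
    ((Some s : Sr) * star (Some s : Sr))%g = (s * star s == t * star t)%g.
Proof.
rewrite !restricted_range_some /idem_le.
rewrite -[X in X == _]/(restricted_mul (Some _) (Some _)) /restricted_mul.
rewrite !(idem_star (idem_mul_star _)) !(idem_mul_star _) eq_sym.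
by have [->|//] := eqVneq (s * star s)%g (t * star t)%g; rewrite idem_mul_star eqxx.
Qed.

(** At the adjoined zero, every operator of the left regular representation of
    S_r copies the value there, and the difference cancels it; elsewhere, two
    ranges of S_r are comparable only if they are equal, which is the condition
    in the restricted left regular representation. *)
Lemma left_regular_sub (s : S) (xi : l2 R Sr) :
  left_regular (Some s : Sr) xi - left_regular (None : Sr) xi =
  l2_ext0 (restricted_left_regular s (l2_restrict xi)).
Proof.
apply: l2_ext => -[t|].
- transitivity ((if (s * star s == t * star t)%g
      then xi (star (Some s : Sr) * Some t)%g else 0) - 0).
    rewrite -restricted_idem_le; congr (_ - _).
    by rewrite /= restricted_range_some.
  rewrite subr0 /=; case: ifP => // st.
  rewrite -[(_ * _)%g]/(restricted_mul (Some (star s)) (Some t)) /restricted_mul.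
  by rewrite starK st.
- transitivity (xi None - xi None); first by [].
  by rewrite subrr.
Qed.

(** Restriction maps the unit ball of l2(S_r) onto that of l2(S), so the two
    operator norms are suprema of the same set. *)
Lemma Lambda_norm_ext0 f :
  Lambda_norm (ext0 f - sum f *: delta0 R S) = lambda_r_norm f.
Proof.
have repE xi :
    rep_ext (@left_regular R Sr) (ext0 f - sum f *: delta0 R S) xi =
    l2_ext0 (rep_ext (@restricted_left_regular R S) f (l2_restrict xi)).
  rewrite rep_ext_correction /rep_ext -sum_l2_ext0; congr sum; apply/funext => s.
  have [iota iotaE] := linear_of l2_ext0_linear.
  by rewrite left_regular_sub -!iotaE linearZ.
rewrite /Lambda_norm /lambda_r_norm /opnorm; congr sup; apply/seteqP; split.
- move=> _ [xi /= xi1 <-]; exists (l2_restrict xi).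
    by rewrite /= (le_trans (rnorm_l2_restrict_le _)).
  by rewrite repE rnorm_l2_ext0.
- move=> _ [xi /= xi1 <-]; exists (l2_ext0 xi).
    by rewrite /= rnorm_l2_ext0.
  by rewrite repE rnorm_l2_ext0 l2_ext0K.
Qed.

End RepresentationNorms.

(** * The isomorphisms *)

Lemma eq0_of_rnorm_small (R : realType) (V : normedModType R[i]) (K : R) (v : V) :
  (forall eps : R, 0 < eps -> rnorm v <= eps * K) -> v = 0.
Proof.
move=> vK; apply/rnorm0_eq0/eqP; rewrite eq_le rnorm_ge0 andbT.
apply/ler_addgt0Pr => eps eps0; rewrite add0r.
have K0 : 0 < `|K| + 1 by rewrite ltr_wpDl.
have r0 : 0 < eps / (`|K| + 1) by rewrite divr_gt0.
rewrite (le_trans (vK _ r0))// mulrAC ler_pdivrMr// ler_wpM2l ?(ltW eps0)//.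
by rewrite (le_trans (ler_norm K))// lerDl.
Qed.

Section Comparison.
Context {R : realType} {S : inverseSemigroupType}.
Variables (N : l1 R S -> R) (N0 : l1 R (restricted S) -> R).
Hypothesis N0_ext0 : forall f, N0 (ext0 f - sum f *: delta0 R S) = N f.
Variable A : cstarCompletion (l1_restricted_alg N).
Variable A0 : cstarCompletion (l1_alg N0).

Local Notation T := (restricted S).
Local Notation emb0 := (completion_emb A0 : l1 R T -> A0).
Local Notation d := (emb0 (delta0 R S)).

Lemma emb_delta0_star : cstar_star d = d.
Proof. by have := completion_emb_star A0 (delta0 R S); rewrite /= delta0_star. Qed.

Lemma emb_delta0_idem : cstar_mul d d = d.
Proof.
have := completion_embM A0 (delta0 R S) (delta0 R S).
by rewrite /= conv_delta0 sum_delta0 scale1r.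
Qed.

Lemma emb_mul_delta0 (f : l1 R T) : cstar_mul (emb0 f) d = sum f *: d.
Proof.
have := completion_embM A0 f (delta0 R S).
by rewrite /= conv_delta0 linearZ.
Qed.

Lemma emb_delta0_mul (f : l1 R T) : cstar_mul d (emb0 f) = sum f *: d.
Proof.
have := completion_embM A0 (delta0 R S) f.
by rewrite /= delta0_conv linearZ.
Qed.

Lemma emb_delta0_central a : cstar_mul a d = cstar_mul d a.
Proof.
apply/eqP; rewrite -subr_eq0; apply/eqP/(@eq0_of_rnorm_small _ _ (rnorm d + rnorm d)).
move=> eps /(emb_approx a)[f af].
have -> : cstar_mul a d - cstar_mul d a =
    cstar_mul (a - emb0 f) d - cstar_mul d (a - emb0 f).
  rewrite cstar_mulBl cstar_mulBr emb_mul_delta0 emb_delta0_mul.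
  by rewrite opprB addrA subrK.
rewrite (le_trans (rnormD _ _))// mulrDr lerD//.
  by rewrite (le_trans (rnorm_cstar_mul _ _))// ler_wpM2r ?rnorm_ge0// ltW.
rewrite /rnorm normrN -/(rnorm _) (le_trans (rnorm_cstar_mul _ _))// mulrC.
by rewrite ler_wpM2r ?rnorm_ge0// ltW.
Qed.

Lemma emb_delta0_ideal a : exists c : R[i], cstar_mul a d = c *: d.
Proof.
apply: (line_closed emb_delta0_star emb_delta0_idem) => eps eps0.
have K0 : 0 < rnorm d + 1 by rewrite ltr_wpDl ?rnorm_ge0.
have r0 : 0 < eps / (rnorm d + 1) by rewrite divr_gt0.
have [f af] := emb_approx a r0.
exists (sum f); rewrite -emb_mul_delta0 -cstar_mulBl.
rewrite (le_lt_trans (rnorm_cstar_mul _ _))//.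
have d1 : rnorm d < rnorm d + 1 by rewrite ltrDl.
move: af; rewrite ltr_pdivlMr//; apply: le_lt_trans.
by rewrite ler_wpM2l ?rnorm_ge0// ltW.
Qed.

Lemma cut_emb_ext0 (f : l1 R S) :
  cut d (emb0 (ext0 f)) = emb0 (ext0 f - sum f *: delta0 R S).
Proof.
have sumE : sum (ext0 f) = sum f.
  apply: (@sum_reindex _ _ _ _ (@Some S : S -> T)) => [x y []//|].
  by case=> [s|]; [exists s|rewrite eqxx].
by rewrite /cut emb_mul_delta0 sumE linearB; congr (_ - _); rewrite linearZ.
Qed.

(** The two sides agree before cutting up to the value at the adjoined zero,
    where a convolution over S_r collects all the pairs with product 0; cutting by
    d removes this discrepancy. *)
Lemma cut_emb_ext0M (f g : l1 R S) :
  cut d (emb0 (ext0 (l1_rconv f g))) =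
  cstar_mul (cut d (emb0 (ext0 f))) (cut d (emb0 (ext0 g))).
Proof.
(* c is fixed by the value at the adjoined zero, where ext0 vanishes. *)
pose c := - l1_conv (ext0 f) (ext0 g) None.
have -> : ext0 (l1_rconv f g) = c *: delta0 R S + l1_conv (ext0 f) (ext0 g).
  apply: l1_ext => -[s|].
    transitivity (c * 0 + l1_conv (ext0 f) (ext0 g) (Some s)); last by [].
    by rewrite mulr0 add0r conv_ext0.
  transitivity (c * 1 + l1_conv (ext0 f) (ext0 g) None); last by [].
  by rewrite mulr1 addNr.
rewrite -cutM; [|exact: emb_delta0_idem|exact: emb_delta0_central].
have embM := completion_embM A0 (ext0 f) (ext0 g); rewrite /= in embM.
rewrite linearP/= -embM cut_linear cut_self; last exact: emb_delta0_idem.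
by rewrite scaler0 add0r.
Qed.

Theorem completion_restricted_isomorphic :
  isometrically_isomorphic A (line_quotient A0 d).
Proof.
have d_star := emb_delta0_star; have d_idem := emb_delta0_idem.
have d_central := emb_delta0_central.
have [g gE] : exists g : {linear l1_restricted_alg N -> (A0 : completeNormedModType R[i])},
    forall f, g f = cut d (emb0 (ext0 f)).
  apply: linear_of => c f h.
  by rewrite ext0_linear linearP cut_linear.
have [||f|Psi [PsiM Psi_star Psi_norm PsiE Psi_onto]] := @isometric_extension _ _ A A0 g.
- by move=> f h; rewrite !gE; exact: cut_emb_ext0M.
- move=> f; rewrite !gE /= ext0_star -cut_star//.
  by have := completion_emb_star A0 (ext0 f) => /= ->.
- rewrite gE cut_emb_ext0.
  by have := completion_emb_norm A0 (ext0 f - sum f *: delta0 R S) => ->; rewrite /= N0_ext0.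
apply: (line_quotient_isomorphic d_star d_idem d_central _ PsiM) => //.
- exact: emb_delta0_ideal.
- move=> b; apply: (@eq0_of_rnorm_small _ _ (rnorm d)) => eps /(emb_approx b)[f bf].
  have -> : cstar_mul (Psi b) d = cstar_mul (Psi (b - completion_emb A f)) d.
    by rewrite linearB cstar_mulBl PsiE gE cut_mul_d// subr0.
  rewrite (le_trans (rnorm_cstar_mul _ _))// ler_wpM2r ?rnorm_ge0//.
  by rewrite Psi_norm ltW.
- move=> a; apply: Psi_onto => eps /(emb_approx a)[f af].
  exists (restrict f).
  have -> : g (restrict f) = cut d (emb0 f).
    rewrite gE [in RHS](ext0_restrict f) addrC linearP cut_linear cut_self//.
    by rewrite scaler0 add0r.
  apply: le_lt_trans af; have := rnorm_cut_le d_star d_idem d_central (a - emb0 f).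
  have -> // : cut d (a - emb0 f) = cut d a - cut d (emb0 f).
  by have := cut_linear d (-1) (emb0 f) a; rewrite !scaleN1r ![- _ + _]addrC.
Qed.

End Comparison.

Theorem proposition4p1 (R : realType) (S : unitalInverseSemigroupType)
  (A_lambda_r : cstarCompletion (l1_restricted_alg (@lambda_r_norm R S)))
  (A_Lambda : cstarCompletion (l1_alg (@Lambda_norm R (restricted S))))
  (A_r : cstarCompletion (l1_restricted_alg (@Sigma_r_norm R S)))
  (A_full : cstarCompletion (l1_alg (@Sigma_norm R (restricted S)))) :
  isometrically_isomorphic A_lambda_r
    (line_quotient A_Lambda (completion_emb A_Lambda (delta0 R S))) /\
  isometrically_isomorphic A_r
    (line_quotient A_full (completion_emb A_full (delta0 R S))).
Proof.
split; apply: completion_restricted_isomorphic.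
- exact: Lambda_norm_ext0.
- exact: Sigma_norm_ext0.
Qed.
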